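(* There is a set $S\subseteq \mathbb Z$ such that for every $m\in\mathbb Z$, the translate $S+m=\{s+m: s\in S\}$ is both a set of recurrence and a WM set of rigidity.
   Context: A measure preserving system $(X,\mu,T)$ is a probability space $(X,\mu)$ with an invertible measurable map $T:X\to X$ preserving $\mu$. A set $S\subseteq\mathbb Z$ is a set of recurrence if for every measure preserving system $(X,\mu,T)$ and every measurable $D\subseteq X$ with $\mu(D)>0$ there exists $n\in S$ with $\mu(D\cap T^nD)>0$. A set $S\subseteq\mathbb Z$ is a set of rigidity for a system $\mathbf X=(X,\mu,T)$ if $S$ is infinite and for every measurable $D\subseteq X$ and every $\varepsilon>0$ the set $\{n\in S:\mu(D\triangle T^nD)>\varepsilon\}$ is finite. $S$ is a WM set of rigidity if it is a set of rigidity for some nontrivial weak mixing measure preserving system. *)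

(* Defs.v *)
From HB Require Import structures.
From mathcomp Require Import all_boot all_order all_algebra.
From mathcomp Require Import all_classical all_reals all_analysis.
Set Implicit Arguments. Unset Strict Implicit. Unset Printing Implicit Defensive.
Import Order.TTheory GRing.Theory Num.Theory.
Import numFieldNormedType.Exports.
Local Open Scope classical_set_scope.
Local Open Scope ring_scope.

Definition mps {d : measure_display} {X : measurableType d} {R : realType}
  (mu : probability X R) (T Tinv : X -> X) : Prop :=
  [/\ measurable_fun setT T, measurable_fun setT Tinv,
      cancel T Tinv, cancel Tinv T &
      forall A : set X, measurable A -> mu (T @^-1` A) = mu A].

Definition Tpow {X : Type} (T Tinv : X -> X) (n : int) : X -> X :=
  match n with
  | Posz k => iter k T
  | Negz k => iter k.+1 Tinv
  end.

Definition Timg {X : Type} (T Tinv : X -> X) (n : int) (D : set X) : set X :=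
  Tpow T Tinv n @` D.

Definition symdiff {X : Type} (A B : set X) : set X := (A `\` B) `|` (B `\` A).

Definition set_of_recurrence (R : realType) (S : set int) : Prop :=
  forall (d : measure_display) (X : measurableType d) (mu : probability X R)
         (T Tinv : X -> X),
    mps mu T Tinv ->
    forall D : set X, measurable D -> (0 < mu D)%E ->
      exists2 n, S n & (0 < mu (D `&` Timg T Tinv n D))%E.

Definition set_of_rigidity {d : measure_display} {X : measurableType d}
  {R : realType} (mu : probability X R) (T Tinv : X -> X) (S : set int) : Prop :=
  ~ finite_set S /\
  forall D : set X, measurable D -> forall eps : R, 0 < eps ->
    finite_set [set n | S n /\ (eps%:E < mu (symdiff D (Timg T Tinv n D)))%E].

Definition weak_mixing {d : measure_display} {X : measurableType d}
  {R : realType} (mu : probability X R) (T : X -> X) : Prop :=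
  forall A B : set X, measurable A -> measurable B ->
    (fun N : nat => N%:R^-1 * \sum_(0 <= n < N)
        `| fine (mu (A `&` (iter n T) @^-1` B)) - fine (mu A) * fine (mu B) |)
      @ \oo --> (0 : R).

Definition nontrivial {d : measure_display} {X : measurableType d}
  {R : realType} (mu : probability X R) : Prop :=
  exists A : set X, [/\ measurable A, (0 < mu A)%E & (mu A < 1)%E].

Definition WM_set_of_rigidity (R : realType) (S : set int) : Prop :=
  exists (d : measure_display) (X : measurableType d) (mu : probability X R)
         (T Tinv : X -> X),
    [/\ mps mu T Tinv, nontrivial mu, weak_mixing mu T &
        set_of_rigidity mu T Tinv S].

Definition translate (S : set int) (m : int) : set int := [set s + m | s in S].

(* Main.v *)
Require Import Defs.
From HB Require Import structures.
From mathcomp Require Import all_boot all_order all_algebra.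
From mathcomp Require Import all_classical all_reals all_analysis.
From mathcomp Require Import measurable_realfun ring lra zify.
Set Implicit Arguments. Unset Strict Implicit. Unset Printing Implicit Defensive.
Import Order.TTheory GRing.Theory Num.Theory.
Import numFieldNormedType.Exports.
Local Open Scope classical_set_scope.
Local Open Scope ring_scope.

(** Each of the systems is an inverse limit of permutations of [0, N k). The
    permutation of level k+1 acts on d k blocks, each of which runs through the
    orbit segments of length a k of level k, and it turns the i-th block
    cyclically with period q_i, where the q_i are pairwise coprime and close to
    the block length. By the Chinese remainder theorem the residues of n modulo
    the q_i are independent when n is uniform, so the correlations of level-k
    events average out over the blocks: this gives weak mixing. Conversely, the
    n that are divisible by most of the q_i are rigidity times.

    One such system is made for every integer m, with all cycle lengths of one
    level coprime, and S collects the n such that most cycle lengths of the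
    m-th system divide n + m, for the first k integers m. For recurrence one
    has to find two visit times a, b in a set A of density at least 1/K in
    [0, Q), such that a - b has prescribed residues modulo most of the q_i. This
    is concentration of measure in the product of the Z/q_i: A and a translate
    of A are close in the Hamming distance, by an Efron-Stein inequality. *)

(** Divisibility by most, rather than all, cycle lengths reconciles the two demands on [S].
    Concentration prescribes the residues of a difference of visit times only up to a few errors,
    and rigidity can afford them: a cycle length that does not divide the time moves points of its
    own block only, so a small proportion of bad blocks moves a small measure.

    The limit of the levels is not an exact one. A block jumps at the end of each orbit segment and
    at the end of its cycle, so the projection to the lower level commutes with the permutations
    only up to an error, summable over the levels. Hence the coordinatewise action need not preserve
    the compatible sequences, while the system must be invertible at every point. The way out is to
    keep all sequences, where the integers act exactly, and to shrink the sigma-algebra to the sets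
    that finite levels approximate along long orbits. The window [W k] is the length of orbit that
    level [k] must follow; it grows fast enough to contain every time that the step below it is
    responsible for. *)

(** * Variance and concentration in products of cyclic groups *)

Lemma sum_sqr_diff (R : realFieldType) (I : finType) (f : I -> R) :
  \sum_i \sum_j (f i - f j) ^+ 2 =
  2 * (#|I|%:R * \sum_i f i ^+ 2 - (\sum_i f i) ^+ 2).
Proof.
have E i : \sum_j (f i - f j) ^+ 2 =
    #|I|%:R * f i ^+ 2 + \sum_j f j ^+ 2 - 2 * f i * \sum_j f j.
  transitivity (\sum_j (f i ^+ 2 + f j ^+ 2 - 2 * f i * f j)).
    by apply: eq_bigr => j _; ring.
  by rewrite sumrB big_split /= sumr_const -[f i ^+ 2 *+ _]mulr_natl mulr_sumr.
under eq_bigr => i _ do rewrite E.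
rewrite sumrB big_split /= sumr_const -mulr_sumr -mulr_suml -mulr_sumr.
by rewrite -mulr_natl expr2; ring.
Qed.

Lemma sum_crt (V : nmodType) (q r : nat) (F : nat -> V) :
  (0 < q)%N -> (0 < r)%N -> coprime q r ->
  (forall x, F (x %% (q * r))%N = F x) ->
  \sum_(x < q * r) F x = \sum_(v < r) \sum_(u < q) F (chinese q r u v).
Proof.
move=> q0 r0 cqr FP; rewrite exchange_big pair_bigA /=.
have qr0 : (0 < q * r)%N by rewrite muln_gt0 q0.
pose h (p : 'I_q * 'I_r) : 'I_(q * r) :=
  Ordinal (ltn_pmod (chinese q r p.1 p.2) qr0).
have hi : injective h.
  move=> [u v] [u' v'] /(congr1 val) /= e.
  have eq1 : chinese q r u v = chinese q r u' v' %[mod q].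
    by rewrite -(modn_dvdm _ (dvdn_mulr r (dvdnn q))) e modn_dvdm ?dvdn_mulr.
  have eq2 : chinese q r u v = chinese q r u' v' %[mod r].
    by rewrite -(modn_dvdm _ (dvdn_mull q (dvdnn r))) e modn_dvdm ?dvdn_mull.
  move: eq1 eq2; rewrite !chinese_modl // !chinese_modr // !modn_small //.
  by move=> /val_inj -> /val_inj ->.
have hb : bijective h by apply: inj_card_bij => //; rewrite card_prod !card_ord.
rewrite (reindex h) /=; last by exact: onW_bij.
by apply: eq_bigr => -[u v] _ /=; rewrite FP.
Qed.

(** The Hamming distance between the images of [x] and [y] in the product of the Z/q. *)
Definition ndiff (qs : seq nat) (x y : nat) : nat :=
  count (fun q => x %% q != y %% q)%N qs.

Arguments ndiff : simpl never.

Definition pairwise_coprime (qs : seq nat) := pairwise coprime qs.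

Definition seqprod (qs : seq nat) : nat := (\prod_(q <- qs) q)%N.

Lemma seqprod_gt0 qs : all (leq 1) qs -> (0 < seqprod qs)%N.
Proof.
by move=> /allP h; rewrite /seqprod big_seq; apply: prodn_cond_gt0 => q /h.
Qed.

Lemma dvdn_seqprod qs q : q \in qs -> (q %| seqprod qs)%N.
Proof. by move=> qin; rewrite /seqprod (big_rem _ qin) dvdn_mulr. Qed.

Lemma coprime_seqprod q qs : all (coprime q) qs -> coprime q (seqprod qs).
Proof.
rewrite /seqprod; elim: qs => [|r qs IH] /=; first by rewrite big_nil coprimen1.
by move=> /andP[cr /IH h]; rewrite big_cons coprimeMr cr.
Qed.

Lemma ndiff_mod qs x : ndiff qs (x %% seqprod qs) x = 0%N.
Proof.
rewrite /ndiff; apply/eqP; rewrite -leqn0 leqNgt -has_count.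
apply/negP => /hasP[q qin]; rewrite modn_dvdm ?eqxx //.
exact: dvdn_seqprod.
Qed.

Lemma ndiff_le_size qs x y : (ndiff qs x y <= size qs)%N.
Proof. exact: count_size. Qed.

Lemma ndiff_sym qs x y : ndiff qs x y = ndiff qs y x.
Proof. by apply: eq_count => q; rewrite eq_sym. Qed.

Lemma ndiff_triangle qs x y z :
  (ndiff qs x z <= ndiff qs x y + ndiff qs y z)%N.
Proof.
rewrite -count_predUI; apply: leq_trans (leq_addr _ _).
by apply: sub_count => q /= xz; case: (eqVneq (x %% q)%N (y %% q)%N) => [<-|].
Qed.

(* An Efron-Stein inequality on the product of the Z/q, seen as Z/Q by the
   Chinese remainder theorem. *)
Lemma variance_lipschitz (R : realFieldType) (qs : seq nat) (f : nat -> R) :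
  pairwise_coprime qs -> all (leq 1) qs ->
  (forall x y, `|f x - f y| <= (ndiff qs x y)%:R) ->
  (seqprod qs)%:R * (\sum_(x < seqprod qs) f x ^+ 2)
   - (\sum_(x < seqprod qs) f x) ^+ 2
  <= (size qs)%:R * (seqprod qs)%:R ^+ 2.
Proof.
elim: qs f => [|q qs IH] f.
  by move=> _ _ _; rewrite /seqprod big_nil !big_ord1 /= mul1r subrr mul0r.
move=> /= /andP[cq cqs] /andP[q0 qs0] flip.
have fP x : f (x %% seqprod (q :: qs))%N = f x.
  apply/eqP; rewrite -subr_eq0 -normr_le0.
  by apply: le_trans (flip _ _) _; rewrite ndiff_mod.
set Q' := seqprod qs; have Q'0 : (0 < Q')%N by exact: seqprod_gt0.
have cqQ : coprime q Q' by exact: coprime_seqprod.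
have chiner u v r : (r %| Q')%N -> chinese q Q' u v = v %[mod r].
  by move=> rQ; rewrite -(modn_dvdm (chinese q Q' u v) rQ) chinese_modr // modn_dvdm.
have QE : seqprod (q :: qs) = (q * Q')%N by rewrite /seqprod big_cons.
rewrite QE in fP *; rewrite (sum_crt q0 Q'0 cqQ (F := f)) //.
rewrite (sum_crt q0 Q'0 cqQ (F := fun x => f x ^+ 2)); last by move=> x; rewrite fP.
(* [g v / q] is the conditional mean of [f] given the residues modulo [qs]; it is again 1-Lipschitz,
   for the remaining coordinates. *)
pose g (v : nat) : R := \sum_(u < q) f (chinese q Q' u v).
have qR : 0 < q%:R :> R by rewrite ltr0n.
have QR : 0 < Q'%:R :> R by rewrite ltr0n.
have := IH (fun v => q%:R^-1 * g v) cqs qs0.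
rewrite -/Q' => /(_ _)/wrap[].
  move=> x y; rewrite -mulrBr normrM gtr0_norm ?invr_gt0 // mulrC.
  rewrite ler_pdivrMr // -sumrB.
  apply: le_trans (ler_norm_sum _ _ _) _.
  rewrite mulr_natr -[in leRHS](card_ord q) -sumr_const; apply: ler_sum => u _.
  apply: le_trans (flip _ _) _; rewrite ler_nat /ndiff /=.
  rewrite !chinese_modl // eqxx add0n leq_eqVlt; apply/orP; left; apply/eqP.
  apply: eq_in_count => r rin /=.
  have rQ : (r %| Q')%N by exact: dvdn_seqprod.
  by rewrite !chiner.
under eq_bigr => v _ do rewrite exprMn.
rewrite -!mulr_sumr exprMn mulrCA -mulrBr exprVn mulrC ler_pdivrMr ?exprn_gt0 //.
move=> IHg.
(* Variance within a fibre: two of its points differ in the residue modulo [q] only, so [f] varies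
   by at most 1. *)
have Hv (v : 'I_Q') : q%:R * (\sum_(u < q) f (chinese q Q' u v) ^+ 2) - g v ^+ 2
    <= q%:R ^+ 2.
  have := sum_sqr_diff (fun u : 'I_q => f (chinese q Q' u v)).
  rewrite card_ord -/(g v) => E.
  have : \sum_(u < q) \sum_(u' < q)
      (f (chinese q Q' u v) - f (chinese q Q' u' v)) ^+ 2
     <= \sum_(u < q) \sum_(u' < q) 1.
    apply: ler_sum => u _; apply: ler_sum => u' _.
    rewrite -real_normK ?num_real // expr_le1 //.
    apply: le_trans (flip _ _) _; rewrite /ndiff /= -[leRHS]/(1%:R) ler_nat.
    rewrite (_ : count _ qs = 0%N) ?addn0; first by case: (_ != _).
    apply/eqP; rewrite -leqn0 leqNgt -has_count; apply/negP => /hasP[r rin].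
    have rQ : (r %| Q')%N by exact: dvdn_seqprod.
    by rewrite !chiner // eqxx.
  rewrite E !sumr_const !card_ord -[_ *+ q]mulr_natr expr2.
  have : 0 <= q%:R * q%:R :> R by rewrite mulr_ge0.
  lra.
have := ler_sum (index_enum 'I_Q') (P := xpredT) (fun v _ => Hv v).
rewrite sumrB -mulr_sumr sumr_const card_ord -[_ *+ Q']mulr_natr.
move=> /(ler_wpM2l (ltW QR)).
have -> : (\sum_(v < Q') \sum_(u < q) f (chinese q Q' u v)) = \sum_(v < Q') g v by [].
rewrite natrM -natr1 -/(g _).
set s := size qs; move: IHg; rewrite -/s.
set G1 := (\sum_(v < Q') g v) ^+ 2; set G2 := \sum_(v < Q') g v ^+ 2.
set F2 := \sum_(v < Q') _; move=> h1 h2.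
(* Total variance as the mean of the fibre variances plus the variance of the fibre means. *)
have -> : q%:R * Q'%:R * F2 - G1
    = Q'%:R * (q%:R * F2 - G2) + (Q'%:R * G2 - G1) by ring.
apply: le_trans (lerD h2 h1) _.
rewrite le_eqVlt; apply/orP; left; apply/eqP; ring.
Qed.

(** The distance to [A] is 1-Lipschitz, vanishes on [A], and is at least [s] on the translate of [A]
    by [c]. The pairs from [A] and its translate thus contribute [|A|^2 * s^2] to the sum of all
    squared differences, which [variance_lipschitz] bounds. *)
Lemma conc (qs : seq nat) (A : pred nat) (c s : nat) :
  pairwise_coprime qs -> all (leq 1) qs ->
  (forall x y, (x < seqprod qs)%N -> (y < seqprod qs)%N -> A x -> A y ->
     (s <= ndiff qs x (y + c))%N) ->
  ((\sum_(x < seqprod qs | A x) 1) ^ 2 * s ^ 2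
     <= 2 * size qs * seqprod qs ^ 2)%N.
Proof.
move=> cqs qs0 sA; set Q := seqprod qs in sA *.
have Q0 : (0 < Q)%N by exact: seqprod_gt0.
have [A0|/existsP[a0 Aa0]] := boolP [forall x : 'I_Q, ~~ A x].
  by rewrite big1 // => x; rewrite (negbTE (forallP A0 x)).
rewrite negbK in Aa0.
have s_size : (s <= size qs)%N.
  exact: leq_trans (sA _ _ (ltn_ord a0) (ltn_ord a0) Aa0 Aa0) (ndiff_le_size _ _ _).
(* The minimum is capped at [size qs]; by [s_size] the cap leaves the lower bound [s] intact. *)
pose f x := (\big[minn/size qs]_(a < Q | A a) ndiff qs x a)%N.
have f_le x (a : 'I_Q) : A a -> (f x <= ndiff qs x a)%N.
  move=> Aa; rewrite /f.
  elim: (index_enum _) (mem_index_enum a) => // b r IH; rewrite inE big_cons.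
  move=> /predU1P[<-|ar]; first by rewrite Aa geq_minl.
  by case: ifP => _; rewrite ?IH // geq_min IH ?orbT.
have f_ge x t : (t <= size qs)%N ->
    (forall a : 'I_Q, A a -> (t <= ndiff qs x a)%N) -> (t <= f x)%N.
  by move=> ts h; rewrite /f; elim/big_rec: _ => // a y Aa ty; rewrite leq_min h.
have f_tri x y : (f x <= f y + ndiff qs x y)%N.
  rewrite addnC -leq_subLR; apply: f_ge => [|a Aa].
    rewrite leq_subLR (leq_trans _ (leq_addl _ _)) //.
    exact: leq_trans (f_le _ _ Aa0) (ndiff_le_size _ _ _).
  by rewrite leq_subLR (leq_trans (f_le _ _ Aa)) // ndiff_triangle.
have := @variance_lipschitz rat qs (fun x => (f x)%:R) cqs qs0.
move=> /(_ _)/wrap[].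
  move=> x y; have := f_tri x y; have := f_tri y x.
  rewrite ndiff_sym -!(ler_nat rat) !natrD ler_norml => h1 h2.
  by apply/andP; split; lra.
rewrite -/Q => V.
have := sum_sqr_diff (fun x : 'I_Q => (f x)%:R : rat); rewrite card_ord => E.
have {E V} : \sum_(x < Q) \sum_(y < Q) ((f x)%:R - (f y)%:R) ^+ 2
    <= 2 * (size qs)%:R * Q%:R ^+ 2 :> rat by rewrite E -mulrA ler_pM2l.
(* Translation by [c] permutes the residues modulo [Q]; after reindexing the inner sum by it, a [y]
   in [A] stands for the point [y + c] of the translate. *)
have hb : bijective (fun y : 'I_Q => Ordinal (ltn_pmod (y + c) Q0)).
  apply: injF_bij => x y /(congr1 val) /= /eqP; rewrite eqn_modDr => /eqP.
  by rewrite !modn_small // => /val_inj.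
move=> H; rewrite -(ler_nat rat) [leLHS]natrM [leRHS]natrM !natrX natrM.
apply: le_trans H.
rewrite natr_sum expr2 mulr_suml mulr_suml.
rewrite [leRHS](bigID (fun x : 'I_Q => A x)) /= -[leLHS]addr0.
apply: lerD; last first.
  by apply: sumr_ge0 => x _; apply: sumr_ge0 => y _; exact: sqr_ge0.
apply: ler_sum => x Ax; rewrite mul1r mulr_suml.
rewrite [leRHS](reindex _ (onW_bij _ hb)) /= [leRHS](bigID (fun x : 'I_Q => A x)) /=.
rewrite -[leLHS]addr0; apply: lerD; last first.
  by apply: sumr_ge0 => y _; exact: sqr_ge0.
apply: ler_sum => y Ay; rewrite mul1r.
have -> : f x = 0%N.
  apply/eqP; rewrite -leqn0 (leq_trans (f_le _ x Ax)) // /ndiff.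
  by rewrite (eq_count (a2 := pred0)) ?count_pred0 // => r /=; rewrite eqxx.
rewrite sub0r sqrrN -!natrX ler_nat leq_exp2r //.
apply: f_ge => // a Aa; rewrite ndiff_sym.
apply: leq_trans (sA _ _ (ltn_ord a) (ltn_ord y) Aa Ay) _.
by rewrite (leq_trans (ndiff_triangle _ _ ((y + c) %% Q)%N _)) // ndiff_mod addn0.
Qed.

(** * Visit times in an arbitrary measure preserving system *)

(** Integrates the number of the [A j] that contain [x]. A null set [N] is excluded because visit
    times are controlled almost everywhere only. *)
Lemma sum_measure_le (R : realType) d (X : measurableType d)
    (mu : probability X R) (Q : nat) (A : nat -> set X) (N : set X) (c : R) :
  (forall j, measurable (A j)) -> measurable N -> mu N = 0%E ->
  (forall x, ~ N x -> \sum_(j < Q) \1_(A j) x <= c) -> 0 <= c ->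
  (\sum_(j < Q) mu (A j) <= c%:E)%E.
Proof.
move=> mA mN N0 hc c0.
have -> : (\sum_(j < Q) mu (A j) =
    \int[mu]_x (\sum_(j < Q) (\1_(A j) x)%:E))%E.
  rewrite ge0_integral_sum //.
  - by apply: eq_bigr => j _; rewrite integral_indic // setIT.
  - by move=> j; apply/measurable_EFinP; exact: measurable_indic.
have -> : c%:E = (\int[mu]_x (cst c%:E x))%E.
  rewrite integral_cst // -[LHS]mule1; congr (_ * _)%E.
  exact/esym/(@probability_setT _ _ _ mu).
apply: ae_ge0_le_integral => //.
- by move=> x _; apply: sume_ge0.
- apply: emeasurable_sum => j; apply/measurable_EFinP.
  exact: measurable_indic.
- exists N; split => // x /= h; apply: contrapT => Nx; apply: h => _.
  by rewrite sumEFin lee_fin; exact: hc.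
Qed.

Lemma crt_seq (qs : seq nat) (r : nat -> nat) :
  pairwise_coprime qs -> all (leq 1) qs ->
  exists c, forall j, (j < size qs)%N -> c = r j %[mod nth 0%N qs j].
Proof.
elim: qs r => [|q qs IH] r /=; first by exists 0%N.
move=> /andP[cq cqs] /andP[q0 qs0].
have [c hc] := IH (fun j => r j.+1) cqs qs0.
have cqQ : coprime q (seqprod qs) by exact: coprime_seqprod.
exists (chinese q (seqprod qs) (r 0%N) c) => -[|j] /=.
  by move=> _; rewrite chinese_modl.
rewrite ltnS => js; rewrite -hc //.
have rQ : (nth 0 qs j %| seqprod qs)%N by apply: dvdn_seqprod; exact: mem_nth.
by rewrite -(modn_dvdm (chinese _ _ _ _) rQ) chinese_modr // modn_dvdm.
Qed.

Section Dynamics.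
Context (R : realType) (d : measure_display) (X : measurableType d).
Context (mu : probability X R) (T Tinv : X -> X) (hT : mps mu T Tinv).

Lemma TpowS n x : Tpow T Tinv (n + 1) x = T (Tpow T Tinv n x).
Proof.
case: hT => _ _ TK KT _.
case: n => [n|[|n]]; first by rewrite -PoszD addn1.
  exact/esym/(KT x).
rewrite (_ : Negz n.+1 + 1 = Negz n); last by lia.
exact/esym/(KT (iter n.+1 Tinv x)).
Qed.

Lemma TpowB1 n x : Tpow T Tinv (n - 1) x = Tinv (Tpow T Tinv n x).
Proof.
case: hT => _ _ TK KT _.
by rewrite -[in RHS](subrK 1 n) TpowS TK.
Qed.

Lemma TpowD m n x : Tpow T Tinv (m + n) x = Tpow T Tinv m (Tpow T Tinv n x).
Proof.
elim/int_rec: m => [|m IH|m IH]; first by rewrite add0r.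
  by rewrite -addn1 PoszD addrAC TpowS IH -TpowS.
by rewrite -addn1 PoszD opprD addrAC TpowB1 IH -TpowB1.
Qed.

Lemma TimgE n D : Timg T Tinv n D = Tpow T Tinv (- n) @^-1` D.
Proof.
apply/seteqP; split=> x /=.
  by move=> [y Dy <-]; rewrite -TpowD addNr.
by move=> Dx; exists (Tpow T Tinv (- n) x) => //; rewrite -TpowD subrr.
Qed.

Lemma measurable_Tpow n : measurable_fun setT (Tpow T Tinv n).
Proof.
case: hT => mT mTi TK KT _.
elim/int_rec: n => [|n IH|n IH]; first exact: measurable_id.
  rewrite (_ : Tpow _ _ _ = T \o Tpow T Tinv n%:Z); last first.
    by apply/funext => x; rewrite -addn1 PoszD TpowS.
  exact: measurableT_comp.
rewrite (_ : Tpow _ _ _ = Tinv \o Tpow T Tinv (- n%:Z)); last first.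
  by apply/funext => x; rewrite -addn1 PoszD opprD TpowB1.
exact: measurableT_comp.
Qed.

Lemma measurable_preTpow n D : measurable D -> measurable (Tpow T Tinv n @^-1` D).
Proof. by move=> mD; rewrite -[X in measurable X]setTI; exact: measurable_Tpow. Qed.

Lemma mu_Tpow n D : measurable D -> mu (Tpow T Tinv n @^-1` D) = mu D.
Proof.
case: hT => mT mTi TK KT muT mD.
elim/int_rec: n => [//|n IH|n IH].
  rewrite -IH -[RHS]muT; last exact: measurable_preTpow.
  rewrite (_ : Tpow _ _ _ = Tpow T Tinv n \o T) //; apply/funext => x.
  by rewrite -addn1 PoszD TpowD.
rewrite -IH -[LHS]muT; last exact: measurable_preTpow.
rewrite [in RHS](_ : Tpow _ _ _ = Tpow T Tinv (- n.+1%:Z) \o T) //.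
apply/funext => x; transitivity (Tpow T Tinv (- n.+1%:Z + 1) x).
  by congr (Tpow _ _ _ _); lia.
exact: TpowD.
Qed.

(** Turns a return at time [a - b] into two visits on one orbit, at times [a] and [b]. *)
Lemma mu_return (a b : nat) (D : set X) : measurable D ->
  mu (D `&` Timg T Tinv (a%:Z - b%:Z) D) =
  mu (Tpow T Tinv a @^-1` D `&` Tpow T Tinv b @^-1` D).
Proof.
move=> mD; rewrite -(mu_Tpow a); last first.
  by apply: measurableI => //; rewrite TimgE; exact: measurable_preTpow.
rewrite TimgE preimage_setI; congr (mu (_ `&` _)).
rewrite -comp_preimage.
suff -> : Tpow T Tinv (- (a%:Z - b%:Z)) \o Tpow T Tinv a = Tpow T Tinv b by [].
apply/funext => x.
transitivity (Tpow T Tinv (- (a%:Z - b%:Z) + a%:Z) x); first exact/esym/TpowD.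
by congr (Tpow _ _ _ _); lia.
Qed.

(** If there were no such [a], [b], then for almost every [x] the visit times of [x] to [D] below
    [Q] would stay at Hamming distance at least [s] from their translate by [c]. By [conc] they
    would have density at most [1/K], and integration over [x] would give [mu D <= 1/K]. *)
Lemma return_times (qs : seq nat) (K c s : nat) (D : set X) :
  pairwise_coprime qs -> all (leq 1) qs -> measurable D ->
  (0 < K)%N -> ((K%:R^-1)%:E < mu D)%E -> (2 * size qs * K ^ 2 <= s ^ 2)%N ->
  (0 < s)%N ->
  exists a b, [/\ (a < seqprod qs)%N, (b < seqprod qs)%N,
    (ndiff qs a (b + c) < s)%N & (0 < mu (D `&` Timg T Tinv (a%:Z - b%:Z) D))%E].
Proof.
move=> cqs qs0 mD K0 hD hs s0; apply: contrapT => hno.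
set Q := seqprod qs.
have Q0 : (0 < Q)%N by exact: seqprod_gt0.
pose A (j : nat) := Tpow T Tinv j @^-1` D.
have mA j : measurable (A j) by exact: measurable_preTpow.
(* The null intersections of two visit events, enumerated through [pickle]. Outside their union [N],
   two visit times of one point always have an intersection of positive measure. *)
pose F (p : nat * nat) :=
  if mu (A p.1 `&` A p.2) == 0%E then A p.1 `&` A p.2 else set0.
pose G n := if unpickle n is Some p then F p else set0.
pose N := \bigcup_n G n.
have mG n : measurable (G n).
  rewrite /G; case: (unpickle n) => // p; rewrite /F; case: ifP => // _.
  exact: measurableI.
have mN : measurable N by exact: bigcup_measurable.
have N0 : mu N = 0%E.
  apply/eqP; rewrite eq_le measure_ge0 andbT.
  apply: le_trans (measure_sigma_subadditive mu mG mN (@subset_refl _ N)) _.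
  rewrite eseries0 // => n _ _; rewrite /G.
  case: (unpickle n) => [p|]; last exact: measure0.
  by rewrite /F; case: ifP => [/eqP|_] //; rewrite measure0.
suff hN x : ~ N x -> \sum_(j < Q) \1_(A j) x <= Q%:R / K%:R :> R.
  have := @sum_measure_le R d X mu Q A N (Q%:R / K%:R) mA mN N0 hN.
  rewrite divr_ge0 // => /(_ isT).
  under eq_bigr => j _ do rewrite /A mu_Tpow //.
  have fD : mu D \is a fin_num by exact: fin_num_measure.
  rewrite -(fineK fD) sumEFin lee_fin sumr_const card_ord -[_ *+ _]mulr_natl.
  by rewrite ler_pM2l ?ltr0n // -lee_fin fineK // leNgt hD.
move=> Nx.
have := @conc qs (fun j => `[< A j x >]) c s cqs qs0.
move=> /(_ _)/wrap[].
  move=> a b aQ bQ /asboolP Aa /asboolP Ab; rewrite leqNgt; apply/negP => lts.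
  have [p0|p0] := eqVneq (mu (A a `&` A b)) 0%E.
    apply: Nx; exists (pickle (a, b)) => //.
    by rewrite /G pickleK /F /= p0 eqxx.
  apply: hno; exists a, b; split => //.
  by rewrite mu_return // lt0e p0 measure_ge0.
rewrite -/Q; set M := (\sum_(x < Q | _) 1)%N => hM.
have -> : \sum_(j < Q) \1_(A j) x = M%:R :> R.
  rewrite /M natr_sum [RHS]big_mkcond /=; apply: eq_bigr => j _.
  rewrite indicE; have [h|h] := pselect (A j x).
    by rewrite mem_set // asboolT.
  by rewrite memNset // asboolF.
rewrite ler_pdivlMr ?ltr0n // -natrM ler_nat.
rewrite -(@leq_exp2r _ _ 2) // -(@leq_pmul2r (s ^ 2)) ?expn_gt0 ?s0 //.
rewrite expnMn mulnAC.
have := leq_mul hM (leqnn (K ^ 2)%N).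
have := leq_mul hs (leqnn (Q ^ 2)%N).
rewrite (_ : 2 * size qs * K ^ 2 * Q ^ 2 = 2 * size qs * Q ^ 2 * K ^ 2)%N; last by lia.
by move=> h1 h2; apply: leq_trans h2 _; rewrite [leqRHS]mulnC.
Qed.

End Dynamics.

(** * One step of the construction: rotating blocks over a given level *)

Lemma sum_block (V : nmodType) (d L : nat) (F : nat -> V) :
  \sum_(y < d * L) F y = \sum_(i < d) \sum_(r < L) F (i * L + r)%N.
Proof.
elim: d => [|d IH]; first by rewrite mul0n !big_ord0.
by rewrite big_ord_recr -IH mulSnr big_split_ord.
Qed.

Lemma sum_geq (L c : nat) : (\sum_(r < L) (c <= r)%N <= L - c)%N.
Proof.
elim: L => [|L IH]; first by rewrite big_ord0.
by rewrite big_ord_recr /=; case: leqP IH => /=; lia.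
Qed.

Lemma sum_ltn (L c : nat) : (\sum_(r < L) (r < c)%N <= c)%N.
Proof.
suff : (\sum_(r < L) (r < c)%N <= minn L c)%N by lia.
elim: L => [|L IH]; first by rewrite big_ord0.
by rewrite big_ord_recr /=; case: ltnP IH => /=; lia.
Qed.

Definition rot (q : nat) (n : int) (r : nat) : nat :=
  `|((r%:Z + n) %% q%:Z)%Z|%N.

Section Rot.
Variable (q : nat).
Hypothesis q0 : (0 < q)%N.

Lemma rotE n r : (rot q n r)%:Z = ((r%:Z + n) %% q%:Z)%Z.
Proof. by rewrite /rot gez0_abs // modz_ge0 //; lia. Qed.

Lemma rot_lt n r : (rot q n r < q)%N.
Proof. by rewrite -ltz_nat rotE ltz_pmod. Qed.

Lemma rotD m n r : rot q (m + n) r = rot q m (rot q n r).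
Proof.
by apply/eqP; rewrite -eqz_nat !rotE modzDml addrA addrAC.
Qed.

Lemma rot_dvd n r : (r < q)%N -> (q%:Z %| n)%Z -> rot q n r = r.
Proof.
move=> rq /dvdzP[k ->]; apply/eqP; rewrite -eqz_nat rotE addrC modzMDl.
by rewrite modz_small //; lia.
Qed.

Lemma rot_small n r s : (r%:Z + n = s%:Z)%R -> (s < q)%N -> rot q n r = s.
Proof. by move=> e sq; apply/eqP; rewrite -eqz_nat rotE e modz_small //; lia. Qed.

Lemma rot_period m n r : (m = n %[mod q%:Z])%Z -> rot q m r = rot q n r.
Proof. by move=> e; rewrite /rot -(modzDmr r%:Z m) e modzDmr. Qed.

End Rot.

Lemma sum_flow (V : nmodType) (N : nat) (fl : int -> nat -> nat) (F : nat -> V) n :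
  (forall n x, (x < N)%N -> (fl n x < N)%N) ->
  (forall n x, (x < N)%N -> fl (- n) (fl n x) = x) ->
  \sum_(x < N) F (fl n x) = \sum_(x < N) F x.
Proof.
move=> flN flK.
pose h (x : 'I_N) : 'I_N := Ordinal (flN n x (ltn_ord x)).
have hb : bijective h.
  apply: injF_bij => x y /(congr1 val) /= e; apply/val_inj.
  by rewrite /= -(flK n x) // e flK.
by rewrite [RHS](reindex h) //; exact: onW_bij.
Qed.

Lemma sum_rot (V : nmodType) (q : nat) (F : nat -> V) n : (0 < q)%N ->
  \sum_(r < q) F (rot q n r) = \sum_(r < q) F r.
Proof.
move=> q0; apply: sum_flow => [m x _|m x xq]; first exact: rot_lt.
by rewrite -rotD // addNr rot_dvd.
Qed.

Lemma sum_rot_period (V : nmodType) (q P : nat) (F : nat -> V) (n : int) r :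
  (0 < q)%N -> (q %| P)%N ->
  \sum_(m < P) F (rot q (m%:Z - n) r) = (\sum_(s < q) F s) *+ (P %/ q).
Proof.
move=> q0 /dvdnP[e ->]; rewrite mulnK // (sum_block _ _ (fun m => F (rot q (m%:Z - n) r))).
rewrite (eq_bigr (fun=> \sum_(s < q) F s)); first by rewrite sumr_const card_ord.
move=> i _; rewrite -(sum_rot F (r%:Z - n) q0); apply: eq_bigr => s _; congr F.
apply/eqP; rewrite -eqz_nat !rotE //; apply/eqP.
rewrite (_ : r%:Z + _ = i%:Z * q%:Z + (s%:Z + (r%:Z - n))); last by rewrite PoszD PoszM; lia.
by rewrite modzMDl.
Qed.

(** A block is longer than its cycle. The leftover positions stay fixed instead of being dropped, so
    that every level is a full interval with the uniform law. *)
Definition stepflow (L : nat) (q : nat -> nat) (n : int) (y : nat) : nat :=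
  if (y %% L < q (y %/ L))%N then (y %/ L * L + rot (q (y %/ L)) n (y %% L))%N
  else y.

(* A block of length N * a lists, for each x < N, the points fl j x, j < a. *)
Definition steppi (L a : nat) (fl : int -> nat -> nat) (y : nat) : nat :=
  fl (y %% a)%N%:Z ((y %% L) %/ a)%N.

Section Stage.
Variables (N a d t : nat) (q : nat -> nat) (fl : int -> nat -> nat).
Let L := (N * a)%N.
Hypotheses (N0 : (0 < N)%N) (a0 : (0 < a)%N).
Hypotheses (q0 : forall i, (0 < q i)%N) (qL : forall i, (q i <= L)%N).
Hypothesis Lq : forall i, (L <= q i + t)%N.
Hypotheses (flN : forall n x, (x < N)%N -> (fl n x < N)%N).
Hypotheses (fl0 : forall x, fl 0 x = x).
Hypotheses (flD : forall m n x, fl (m + n) x = fl m (fl n x)).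

Let L0 : (0 < L)%N. Proof. by rewrite muln_gt0 N0. Qed.

Lemma stepflow_block n i r : (r < L)%N ->
  stepflow L q n (i * L + r) =
  (i * L + (if r < q i then rot (q i) n r else r))%N.
Proof.
by move=> rL; rewrite /stepflow divnMDl // divn_small // addn0 modnMDl modn_small //; case: ifP.
Qed.

Lemma rot_ltL n i r : (r < L)%N ->
  ((if r < q i then rot (q i) n r else r) < L)%N.
Proof. by move=> rL; case: ifP => // _; exact: leq_trans (rot_lt _ _ _) _. Qed.

Lemma stepflow_lt n y : (y < d * L)%N -> (stepflow L q n y < d * L)%N.
Proof.
move=> yd; rewrite (divn_eq y L) stepflow_block ?ltn_pmod //.
have := rot_ltL n (y %/ L) (ltn_pmod y L0).
have : (y %/ L < d)%N by rewrite ltn_divLR.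
move: (if _ then _ else _) => r i_d rL.
apply: (@leq_trans ((y %/ L).+1 * L)); last by rewrite leq_mul2r i_d orbT.
by rewrite mulSn addnC ltn_add2r.
Qed.

Lemma stepflow0 y : stepflow L q 0 y = y.
Proof.
rewrite [in LHS](divn_eq y L) stepflow_block ?ltn_pmod //.
by case: ifP => h; rewrite ?rot_dvd // -divn_eq.
Qed.

Lemma stepflowD m n y : stepflow L q (m + n) y = stepflow L q m (stepflow L q n y).
Proof.
rewrite (divn_eq y L) !stepflow_block ?ltn_pmod ?rot_ltL ?ltn_pmod //.
congr (_ + _)%N; case: ifP => h; last by rewrite h.
by rewrite rot_lt // rotD.
Qed.

(** For each offset [j < a] the map [fl j] permutes [0, N), so each point of the lower level occurs
    exactly [a] times in a block: the uniform law projects to the uniform law, block by block. *)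
Lemma sum_steppi (V : nmodType) (F : nat -> V) i :
  \sum_(r < L) F (steppi L a fl (i * L + r)%N) = (\sum_(x < N) F x) *+ a.
Proof.
rewrite (sum_block _ _ (fun r => F (steppi L a fl (i * L + r)%N))) exchange_big /= -[in RHS](card_ord a) -sumr_const.
apply: eq_bigr => j _.
rewrite -(sum_flow F j%:Z flN); last by move=> n x _; rewrite -flD addNr fl0.
apply: eq_bigr => x _; congr F; rewrite /steppi.
have xL : (x * a + j < L)%N.
  apply: (@leq_trans (x.+1 * a)); last by rewrite leq_mul2r ltn_ord orbT.
  by rewrite mulSn addnC ltn_add2r.
have -> : ((i * L + (x * a + j)) %% a = j)%N.
  by rewrite /L mulnA addnA -mulnDl modnMDl modn_small.
by rewrite modnMDl modn_small // divnMDl // divn_small // addn0.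
Qed.

(** A block whose cycle length divides [n] is fixed pointwise; any other block is counted in
    full. *)
Lemma stepflow_fixed n :
  (\sum_(y < d * L) (stepflow L q n y != y) <=
   (\sum_(i < d) (~~ ((q i)%:Z %| n)%Z)) * L)%N.
Proof.
rewrite (sum_block _ _ (fun y => (stepflow L q n y != y) : nat)) big_distrl /=; apply: leq_sum => i _.
apply: (@leq_trans (\sum_(r < L) (~~ ((q i)%:Z %| n)%Z : nat))%N); last first.
  by rewrite sum_nat_const card_ord mulnC.
apply: leq_sum => r _; rewrite stepflow_block // eqn_add2l.
case: ifP => h; last by rewrite eqxx.
have [hq|_] := boolP ((q i)%:Z %| n)%Z; last exact: leq_b1.
by rewrite rot_dvd // eqxx.
Qed.

(** As long as the shift by [n] leaves neither the segment of length [a] nor the cycle, it only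
    changes the offset [j] in [fl j x], and equivariance is exact. In one block the segment is left
    from at most [N * |n|] positions, and at most [|n| + t] positions are too close to the end of
    the cycle or beyond it. *)
Lemma stepflow_error n :
  (\sum_(y < d * L)
     (steppi L a fl (stepflow L q n y) != fl n (steppi L a fl y)) <=
   d * (N * `|n| + `|n| + t))%N.
Proof.
rewrite (sum_block _ _ (fun y => (steppi L a fl (stepflow L q n y) != fl n (steppi L a fl y)) : nat)).
rewrite -[X in (_ <= X * _)%N]card_ord -sum_nat_const.
apply: leq_sum => i _.
apply: (@leq_trans (\sum_(r < L) ((~~ (0 <= (r %% a)%N%:Z + n < a%:Z)%R) + (q i - `|n| <= r)))%N).
  apply: leq_sum => r _; case: (boolP (0 <= _ < _)) => h; last first.
    by apply: leq_trans (leq_b1 _) _; rewrite leq_addr.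
  case: (leqP (q i - `|n|) r) => [|hr]; first by rewrite add0n leq_b1.
  rewrite leqn0 eqb0 negbK stepflow_block // ifT; last by apply: leq_trans hr _; exact: leq_subr.
  have [j jE] : exists j : nat, (r %% a)%N%:Z + n = j%:Z.
    by exists `|((r %% a)%N%:Z + n)%R|%N; rewrite gez0_abs //; case/andP: h.
  have ja : (j < a)%N by move: h; rewrite jE => /andP[_]; rewrite ltz_nat.
  have e : (r : nat)%:Z + n = ((r %/ a) * a + j)%N%:Z.
    by rewrite PoszD -jE {1}(divn_eq r a) PoszD addrA.
  rewrite (rot_small _ e) //; last first.
    by rewrite -ltz_nat -e; move: hr; lia.
  have jL : (r %/ a * a + j < L)%N.
    apply: (@leq_trans ((r %/ a).+1 * a)); first by rewrite mulSn addnC ltn_add2r.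
    by rewrite leq_mul2r ltn_divLR // ltn_ord orbT.
  rewrite /steppi !modnMDl !(modn_small (d := L)) // divnMDl // (divn_small ja) addn0.
  have mE s : ((i * L + s) %% a = s %% a)%N by rewrite /L mulnA modnMDl.
  by rewrite !mE modnMDl modn_small // -flD addrC jE.
rewrite big_split /= -addnA; apply: leq_add; last first.
  by apply: leq_trans (sum_geq _ _) _; move: (Lq i); lia.
rewrite (sum_block _ _ (fun r => (~~ (0 <= (r %% a)%N%:Z + n < a%:Z)%R) : nat)).
rewrite -[X in (_ <= X * _)%N]card_ord -sum_nat_const.
apply: leq_sum => x _.
under eq_bigr => j _ do rewrite modnMDl modn_small //.
case: n => n.
  apply: leq_trans (_ : \sum_(j < a) (a - n <= j) <= _)%N.
    by apply: leq_sum => j _; case: (leqP (a - n) j) => h; [rewrite leq_b1|rewrite leqn0 eqb0 negbK; lia].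
  by apply: leq_trans (sum_geq _ _) _; lia.
apply: leq_trans (_ : \sum_(j < a) (j < n.+1) <= _)%N; last by apply: leq_trans (sum_ltn _ _) _; lia.
by apply: leq_sum => j _; case: (leqP n.+1 j) => h; [rewrite leqn0 eqb0 negbK; have := ltn_ord j; lia|rewrite leq_b1].
Qed.

End Stage.

(** * Correlations of lower-level events across one step *)

(** The mean square deviation from [b] is the variance plus the squared bias. *)
Lemma second_moment (R : realFieldType) (Q : nat) (f : nat -> R) (M s b e : R) :
  (0 < Q)%N -> \sum_(m < Q) f m = Q%:R * M ->
  Q%:R * (\sum_(m < Q) f m ^+ 2) - (\sum_(m < Q) f m) ^+ 2 <= s * Q%:R ^+ 2 ->
  `|M - b| <= e ->
  \sum_(m < Q) (f m - b) ^+ 2 <= Q%:R * (s + e ^+ 2).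
Proof.
move=> Q0 fM V hM; have QR : 0 < Q%:R :> R by rewrite ltr0n.
have -> : \sum_(m < Q) (f m - b) ^+ 2 =
    \sum_(m < Q) f m ^+ 2 - 2 * b * (Q%:R * M) + Q%:R * b ^+ 2.
  rewrite -fM; transitivity (\sum_(m < Q) (f m ^+ 2 - 2 * b * f m + b ^+ 2)).
    by apply: eq_bigr => m _; ring.
  by rewrite big_split sumrB /= sumr_const card_ord -[b ^+ 2 *+ _]mulr_natl mulr_sumr.
rewrite fM in V; set F2 := \sum_(m < Q) _ in V *.
have V' : F2 - Q%:R * M ^+ 2 <= s * Q%:R.
  rewrite -(ler_pM2l QR); apply: le_trans (le_trans _ V) _; last by rewrite le_eqVlt; apply/orP; left; apply/eqP; ring.
  by rewrite le_eqVlt; apply/orP; left; apply/eqP; ring.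
have e2 : (M - b) ^+ 2 <= e ^+ 2.
  by rewrite -real_normK ?num_real // lerXn2r // ?nnegrE // (le_trans _ hM).
have := ler_wpM2l (ltW QR) e2.
nra.
Qed.

(** [S] and [U] stand for the number of points of an event in the rotating and in the fixed part of
    a block. Averaged over a period, the rotating part decorrelates exactly and contributes
    [S^2 / q], while the fixed part stays fully correlated and contributes [U]. As the fixed part is
    short, the result is close to the squared density. *)
Lemma block_mean_bound (R : realFieldType) (q L t S U : R) :
  0 < q -> q <= L -> L <= q + t -> 0 <= S -> S <= q -> 0 <= U -> U <= L - q ->
  `|(S ^+ 2 / q + U) / L - ((S + U) / L) ^+ 2| <= 2 * t / L.
Proof.
move=> q0 qL Lt S0 Sq U0 Ul.
have L0 : 0 < L by lra.
pose u := S / q; pose w := S / L; pose e := (L - q) / L; pose v := U / L.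
have -> : (S ^+ 2 / q + U) / L = u * w + v.
  by rewrite /u /w /v; field; rewrite ?gt_eqF.
have -> : (S + U) / L = w + v by rewrite /w /v; field; rewrite gt_eqF.
have et : e <= t / L by rewrite ler_pM2r ?invr_gt0 //; lra.
have u01 : 0 <= u <= 1.
  by apply/andP; split; [apply: divr_ge0; lra | rewrite ler_pdivrMr // mul1r].
have wu : w = u * (1 - e).
  by rewrite /w /u /e; field; rewrite ?gt_eqF.
have e01 : 0 <= e <= 1.
  by apply/andP; split; [apply: divr_ge0; lra | rewrite ler_pdivrMr // mul1r; lra].
have v0 : 0 <= v by apply: divr_ge0; lra.
have ve : v <= e by rewrite ler_pM2r ?invr_gt0.
have -> : 2 * t / L = 2 * (t / L) by rewrite mulrA.
move: (t / L) et => tau et.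
clearbody u w e v.
case/andP: u01 => u0 u1; case/andP: e01 => e0 e1.
(* The first defect comes from the cycle being shorter than the block, the second from the fixed
   part; each has size at most [e], the leftover proportion. *)
have -> : u * w + v - (w + v) ^+ 2 = w * (u * e) + v * (1 - 2 * w - v).
  by rewrite [in u * w]wu; move: wu => ->; ring.
have w0 : 0 <= w by rewrite wu mulr_ge0 // subr_ge0.
have w1 : w <= 1 - e by rewrite wu ler_piMl // subr_ge0.
have h1 : 0 <= w * (u * e) <= e.
  have ue : 0 <= u * e by exact: mulr_ge0.
  apply/andP; split; first exact: mulr_ge0.
  have ? : u * e <= e by exact: ler_piMl.
  have ? : w * (u * e) <= u * e by apply: ler_piMl; [exact: mulr_ge0 | lra].
  lra.
have h2 : v * (1 - 2 * w - v) <= v by apply: ler_piMr; lra.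
have h3 : - v <= v * (1 - 2 * w - v) by rewrite -mulrN1; apply: ler_wpM2l; lra.
by rewrite ler_norml; apply/andP; split; lra.
Qed.

Section Correlation.
Variables (R : realFieldType) (N a d t : nat) (q : nat -> nat).
Variables (fl : int -> nat -> nat).
Let L := (N * a)%N.
Hypotheses (N0 : (0 < N)%N) (a0 : (0 < a)%N) (d0 : (0 < d)%N).
Hypotheses (q0 : forall i, (0 < q i)%N) (qL : forall i, (q i <= L)%N).
Hypothesis Lq : forall i, (L <= q i + t)%N.
Hypotheses (flN : forall n x, (x < N)%N -> (fl n x < N)%N).
Hypotheses (fl0 : forall x, fl 0 x = x).
Hypotheses (flD : forall m n x, fl (m + n) x = fl m (fl n x)).
Variable (B : pred nat).

Definition stepcorr (n : int) : R :=
  (\sum_(y < d * L) (B (steppi L a fl y) && B (steppi L a fl (stepflow L q n y)))%:R)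
  / (d * L)%:R.

Definition density : R := (\sum_(x < N) (B x)%:R) / N%:R.

Let g i r : R := (B (steppi L a fl (i * L + r)%N))%:R.
Let cc i n : R :=
  (\sum_(r < L) g i r * g i (if (r < q i)%N then rot (q i) n r else r)) / L%:R.

Let L0 : (0 < L)%N. Proof. by rewrite muln_gt0 N0. Qed.
Let g0 i r : 0 <= g i r. Proof. exact: ler0n. Qed.
Let g1 i r : g i r <= 1. Proof. by rewrite /g -[leRHS]/(1%:R) ler_nat leq_b1. Qed.
Let gg i r : g i r * g i r = g i r.
Proof. by rewrite /g; case: (B _); rewrite ?mulr1 ?mulr0. Qed.

Let stepcorrE n : stepcorr n = (\sum_(i < d) cc i n) / d%:R.
Proof.
rewrite /stepcorr (sum_block _ _ (fun y => (B (steppi L a fl y) &&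
   B (steppi L a fl (stepflow L q n y)))%:R)) natrM invfM mulrA mulrAC.
congr (_ / _); rewrite mulr_suml; apply: eq_bigr => i _; congr (_ / _).
by apply: eq_bigr => r _; rewrite stepflow_block // -mulnb natrM.
Qed.

Let cc01 i n : 0 <= cc i n <= 1.
Proof.
rewrite divr_ge0 ?sumr_ge0 //=; last by move=> r _; rewrite mulr_ge0.
rewrite ler_pdivrMr ?ltr0n // mul1r -[leRHS]mulr1 mulr_natl -[in leRHS](card_ord L) -sumr_const.
by apply: ler_sum => r _; rewrite mulr_ile1.
Qed.

(** A block sees the time through its residue modulo [q i] only, so the sum of the block
    correlations is Lipschitz for the Hamming distance. *)
Let cc_mod i (x y : nat) (n0 : int) : x = y %[mod q i] ->
  cc i (x%:Z - n0) = cc i (y%:Z - n0).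
Proof.
move=> e; congr (_ / _); apply: eq_bigr => r _; congr (_ * g i _).
case: ifP => // _; apply: rot_period.
apply/eqP; rewrite eqz_mod_dvd opprB addrA subrK -eqz_mod_dvd.
by rewrite !modz_nat e.
Qed.

Let cc_sum i P n0 : (q i %| P)%N ->
  exists S U, [/\ 0 <= S, S <= (q i)%:R, 0 <= U, U <= L%:R - (q i)%:R &
    (S + U) / L%:R = density /\
    \sum_(m < P) cc i (m%:Z - n0) = P%:R * ((S ^+ 2 / (q i)%:R + U) / L%:R)].
Proof.
move=> qP; pose S := \sum_(r < q i) g i r.
pose U := \sum_(r < L | ~~ (r < q i)%N) g i r.
have SU : S + U = \sum_(r < L) g i r.
  by rewrite [RHS](bigID (fun r : 'I_L => (r < q i)%N)) /= /S (big_ord_widen L).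
exists S, U; split.
- exact: sumr_ge0.
- rewrite -[leRHS]mulr1 mulr_natl -[in leRHS](card_ord (q i)) -sumr_const.
  exact: ler_sum.
- exact: sumr_ge0.
- have -> : L%:R - (q i)%:R = \sum_(r < L | ~~ (r < q i)%N) (1 : R).
    have : \sum_(r < L) (1 : R) = L%:R by rewrite sumr_const card_ord.
    rewrite (bigID (fun r : 'I_L => (r < q i)%N)) /= => <-.
    rewrite -(big_ord_widen L (fun=> 1)) // sumr_const card_ord addrAC subrr add0r //.
  exact: ler_sum.
- split.
  rewrite SU /density (sum_steppi a0 flN fl0 flD (fun x => (B x)%:R : R)).
  rewrite -[X in X / L%:R = _]mulr_natr /L natrM; field.
  by rewrite !pnatr_eq0 -!lt0n N0 a0.
rewrite -mulr_suml mulrA; congr (_ / _).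
  transitivity (\sum_(m < P) (\sum_(r < q i) g i r * g i (rot (q i) (m%:Z - n0) r) + U)).
    apply: eq_bigr => m _; rewrite (bigID (fun r : 'I_L => (r < q i)%N)) /=.
    congr (_ + _); last by apply: eq_bigr => r /negbTE ->; exact: gg.
    rewrite (big_ord_widen L (fun r => g i r * g i (rot (q i) (m%:Z - n0) r))) //.
    by apply: eq_bigr => r ->.
  rewrite big_split /= sumr_const card_ord -[U *+ _]mulr_natl mulrDr; congr (_ + _).
  rewrite exchange_big /=.
  under eq_bigr => r _ do rewrite -mulr_sumr sum_rot_period //.
  rewrite -mulr_suml -/S -/S -[S *+ _]mulr_natr.
  have {2}-> : P = (P %/ q i * q i)%N by rewrite divnK.
  rewrite natrM; field; by rewrite pnatr_eq0 -lt0n.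
Qed.

(** The correlation is a mean of [d] block correlations with values in [0, 1]; its variance is at
    most [size qs / d^2] by [variance_lipschitz], and its bias is bounded by [block_mean_bound]. The
    list [qs] may be longer than that of the [q i], since it also holds the cycle lengths of other
    systems. *)
Lemma stepcorr_variance (qs : seq nat) (n0 : int) :
  pairwise_coprime qs -> all (leq 1) qs ->
  (forall i, (i < d)%N -> q i \in qs) ->
  (forall x y, (\sum_(i < d) (x %% q i != y %% q i) <= ndiff qs x y)%N) ->
  \sum_(m < seqprod qs) (stepcorr (m%:Z - n0) - density ^+ 2) ^+ 2 <=
  (seqprod qs)%:R * ((size qs)%:R / d%:R ^+ 2 + (2 * t%:R / L%:R) ^+ 2).
Proof.
move=> cqs qs0 qin hnd; set Q := seqprod qs.
have Q0 : (0 < Q)%N by exact: seqprod_gt0.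
have dR : 0 < d%:R :> R by rewrite ltr0n.
have QR : 0 < Q%:R :> R by rewrite ltr0n.
pose f (m : nat) := stepcorr (m%:Z - n0).
pose M : R := (\sum_(m < Q) f m) / Q%:R.
apply: (second_moment (f := f) (M := M)) => //.
- by rewrite /M mulrCA divff ?mulr1 // gt_eqF.
- have := @variance_lipschitz R qs (fun m => \sum_(i < d) cc i (m%:Z - n0)) cqs qs0.
  move=> /(_ _)/wrap[].
    move=> x y; rewrite -sumrB; apply: le_trans (ler_norm_sum _ _ _) _.
    apply: le_trans (_ : (\sum_(i < d) (x %% q i != y %% q i)%N)%:R <= _); last by rewrite ler_nat.
    rewrite natr_sum; apply: ler_sum => i _.
    case: eqVneq => [e|_] /=; first by rewrite (cc_mod _ e) subrr normr0.
    have /andP[h1 h2] := cc01 i (x%:Z - n0); have /andP[h3 h4] := cc01 i (y%:Z - n0).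
    by rewrite ler_norml; apply/andP; split; lra.
  rewrite -/Q => V.
  have fE m : f m = (\sum_(i < d) cc i (m%:Z - n0)) * d%:R^-1 by exact: stepcorrE.
  under eq_bigr => m _ do rewrite fE exprMn.
  under [X in _ - X ^+ 2]eq_bigr => m _ do rewrite fE.
  rewrite -!mulr_suml exprMn mulrA -mulrBl.
  rewrite [leRHS](_ : _ = (size qs)%:R * Q%:R ^+ 2 * d%:R^-1 ^+ 2); last first.
    by rewrite exprVn mulrAC.
  by rewrite ler_wpM2r // exprn_ge0 // invr_ge0 ltW.
- have hi (i : 'I_d) : `|(\sum_(m < Q) cc i (m%:Z - n0)) / Q%:R - density ^+ 2| <= 2 * t%:R / L%:R.
    have [|S [U [S0 Sq U0 UL [<- ->]]]] := @cc_sum i Q n0; first by apply: dvdn_seqprod; exact: qin.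
    rewrite mulrAC divff ?gt_eqF // mul1r.
    apply: block_mean_bound => //; rewrite ?ltr0n ?ler_nat //.
    by rewrite -natrD ler_nat.
  have -> : M - density ^+ 2 =
     (\sum_(i < d) ((\sum_(m < Q) cc i (m%:Z - n0)) / Q%:R - density ^+ 2)) / d%:R.
    rewrite sumrB sumr_const card_ord mulrBl -(mulr_natr (density ^+ 2)) mulfK ?gt_eqF //.
    have fE : \sum_(m < Q) f m = (\sum_(i < d) \sum_(m < Q) cc i (m%:Z - n0)) / d%:R.
      rewrite exchange_big mulr_suml; apply: eq_bigr => m _; exact: stepcorrE.
    by rewrite /M fE -mulr_suml mulrAC.
  rewrite normrM (gtr0_norm (x := d%:R^-1)) ?invr_gt0 // ler_pdivrMr //.
  apply: le_trans (ler_norm_sum _ _ _) _.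
  rewrite [leRHS]mulr_natr -[in leRHS](card_ord d) -sumr_const.
  by apply: ler_sum => i _; exact: hi.
Qed.

End Correlation.

(** Cauchy-Schwarz without square roots, from [|x| <= (x^2 / e + e) / 2]. *)
Lemma sum_norm_le_sqr (R : realFieldType) (Q : nat) (f : nat -> R) (eta e : R) :
  \sum_(m < Q) f m ^+ 2 <= Q%:R * eta -> 0 < e -> eta <= e ^+ 2 ->
  \sum_(m < Q) `|f m| <= Q%:R * e.
Proof.
move=> hf e0 he.
have amgm (x : R) : `|x| <= (x ^+ 2 / e + e) / 2.
  have hz : x ^+ 2 / e * e = `|x| ^+ 2 by rewrite divfK ?gt_eqF // real_normK ?num_real.
  rewrite -(ler_pM2r e0); move: (x ^+ 2 / e) hz => z hz.
  by have := sqr_ge0 (`|x| - e); nra.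
apply: (@le_trans _ _ (\sum_(m < Q) ((f m ^+ 2 / e + e) / 2))).
  by apply: ler_sum.
rewrite -mulr_suml ler_pdivrMr // big_split /= -mulr_suml sumr_const card_ord.
set F := \sum_(m < Q) _ in hf *; rewrite -(mulr_natl e) -(ler_pM2r e0).
have hz : F / e * e = F by rewrite divfK ?gt_eqF.
have : Q%:R * eta <= Q%:R * e ^+ 2 by rewrite ler_wpM2l.
move: (F / e) hz => z hz; nra.
Qed.

(** With the signs of the inner sums as coefficients, the left side becomes the pairing of [al] with
    the single vector [H]. The square norm of [H] expands into the pairwise correlations of the
    [h n], which are small on average. The weight [al] enters through [0 <= al <= 1/N] alone, so the
    bound is uniform over the events it comes from. *)
Lemma weighted_correlation_bound (R : realFieldType) (N Q : nat)
    (al : nat -> R) (h : nat -> nat -> R) (e : R) :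
  (0 < N)%N -> 0 < e -> (forall y, (y < N)%N -> 0 <= al y <= N%:R^-1) ->
  (forall n, (n < Q)%N ->
     \sum_(m < Q) `|(\sum_(y < N) h n y * h m y) / N%:R| <= Q%:R * e ^+ 2) ->
  \sum_(n < Q) `|\sum_(y < N) al y * h n y| <= Q%:R * e.
Proof.
move=> N0 e0 hal hh.
have [->|Q0] := posnP Q; first by rewrite big_ord0 mul0r.
have QR : 0 < Q%:R :> R by rewrite ltr0n.
have NR : 0 < N%:R :> R by rewrite ltr0n.
pose s n : R := Num.sg (\sum_(y < N) al y * h n y).
have s1 n : `|s n| <= 1 by rewrite /s normr_sg; case: (_ == 0) => //=; rewrite ?ler01.
pose H y := \sum_(n < Q) s n * h n y.
have -> : \sum_(n < Q) `|\sum_(y < N) al y * h n y| = \sum_(y < N) al y * H y.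
  rewrite /H; under [RHS]eq_bigr => y _ do rewrite mulr_sumr.
  rewrite exchange_big /=; apply: eq_bigr => n _.
  rewrite normrEsg mulr_sumr; apply: eq_bigr => y _.
  by rewrite mulrCA.
have HH : \sum_(y < N) H y ^+ 2 <= N%:R * (Q%:R * e) ^+ 2.
  have -> : \sum_(y < N) H y ^+ 2 =
     \sum_(n < Q) \sum_(m < Q) s n * s m * (\sum_(y < N) h n y * h m y).
    under eq_bigr => y _ do rewrite expr2 /H mulr_suml.
    rewrite exchange_big /=; apply: eq_bigr => n _.
    under eq_bigr => y _ do rewrite mulr_sumr.
    rewrite exchange_big /=; apply: eq_bigr => m _; rewrite mulr_sumr.
    by apply: eq_bigr => y _; ring.
  rewrite exprMn [leRHS](_ : _ = N%:R * (\sum_(n < Q) Q%:R * e ^+ 2)); last first.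
    by rewrite sumr_const card_ord -(mulr_natl (_ * _)); ring.
  rewrite mulr_sumr; apply: ler_sum => n _.
  apply: le_trans (_ : N%:R * \sum_(m < Q) `|(\sum_(y < N) h n y * h m y) / N%:R| <= _).
    rewrite mulr_sumr; apply: ler_sum => m _.
    rewrite normrM (gtr0_norm (x := _^-1)) ?invr_gt0 // mulrCA divff ?gt_eqF // mulr1.
    apply: le_trans (ler_norm _) _; rewrite normrM normrM.
    by apply: ler_piMl => //; apply: mulr_ile1.
  by rewrite ler_pM2l // hh.
apply: le_trans (_ : \sum_(y < N) `|H y| / N%:R <= _).
  apply: ler_sum => y _; have /andP[a0 a1] := hal y (ltn_ord y).
  apply: le_trans (_ : al y * `|H y| <= _); first by rewrite ler_wpM2l // ler_norm.
  by rewrite mulrC ler_wpM2l.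
rewrite -mulr_suml ler_pdivrMr // mulrC.
apply: (sum_norm_le_sqr (eta := (Q%:R * e) ^+ 2)) => //.
exact: mulr_gt0.
Qed.

(** * Real-valued probabilities and symmetric differences *)

Section RealProbability.
Context (R : realType) (d : measure_display) (Om : measurableType d).
Context (P : probability Om R).

Definition pr (A : set Om) : R := fine (P A).

Lemma prE A : measurable A -> P A = (pr A)%:E.
Proof. by move=> mA; rewrite /pr fineK // fin_num_measure. Qed.

Lemma pr_ge0 A : 0 <= pr A.
Proof. by rewrite fine_ge0. Qed.

Lemma pr_le A B : measurable A -> measurable B -> A `<=` B -> pr A <= pr B.
Proof.
by move=> mA mB AB; rewrite -lee_fin -!prE //; apply: le_measure; rewrite ?inE.
Qed.

Lemma prU_le A B : measurable A -> measurable B ->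
  pr (A `|` B) <= pr A + pr B.
Proof.
move=> mA mB; rewrite -lee_fin EFinD -!prE //; last exact: measurableU.
exact: measureU2.
Qed.

Lemma prU A B : measurable A -> measurable B -> A `&` B = set0 ->
  pr (A `|` B) = pr A + pr B.
Proof.
move=> mA mB AB; apply/eqP; rewrite -eqe EFinD -!prE //; last exact: measurableU.
by rewrite measureU.
Qed.

Lemma prD A B : measurable A -> measurable B -> B `<=` A ->
  pr (A `\` B) = pr A - pr B.
Proof.
move=> mA mB BA; have := prU (measurableD mA mB) mB.
rewrite setUC setDUK // => ->; first by rewrite addrK.
by rewrite setDE -setIA [~` B `&` B]setIC setICr setI0.
Qed.

Lemma pr_bigcup_cvg (F : nat -> set Om) : (forall i, measurable (F i)) ->
  nondecreasing_seq F -> (pr \o F) @ \oo --> pr (\bigcup_n F n).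
Proof.
move=> mF ndF; apply: fine_cvg; rewrite -prE; last exact: bigcup_measurable.
by apply: nondecreasing_cvg_mu => //; exact: bigcup_measurable.
Qed.

(** Symmetric difference, stated as a failing equivalence to keep membership arguments
    propositional. *)
Definition sd (A B : set Om) : set Om := [set w | ~ (A w <-> B w)].

Lemma sdE A B : sd A B = (A `\` B) `|` (B `\` A).
Proof.
apply/seteqP; split => w /=; rewrite /sd /=.
  by have [a|a] := pselect (A w); have [b|b] := pselect (B w); tauto.
by tauto.
Qed.

Lemma measurable_sd A B : measurable A -> measurable B -> measurable (sd A B).
Proof. by move=> mA mB; rewrite sdE; apply: measurableU; exact: measurableD. Qed.

Lemma sdC A B : sd A B = sd B A.
Proof. by rewrite !sdE setUC. Qed.

Lemma pr_sd_triangle A B C : measurable A -> measurable B -> measurable C ->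
  pr (sd A C) <= pr (sd A B) + pr (sd B C).
Proof.
move=> mA mB mC.
apply: le_trans (prU_le (measurable_sd mA mB) (measurable_sd mB mC)).
apply: pr_le; [exact: measurable_sd|by apply: measurableU; exact: measurable_sd|].
move=> w /= h; have [b|b] := pselect (sd A B w); [by left|right].
by move: h b; rewrite /sd /=; tauto.
Qed.

Lemma pr_sd_setI A B E : measurable A -> measurable B -> measurable E ->
  `|pr (E `&` A) - pr (E `&` B)| <= pr (sd A B).
Proof.
move=> mA mB mE.
have h X Y : measurable X -> measurable Y -> pr (E `&` X) <= pr (E `&` Y) + pr (sd X Y).
  move=> mX mY; apply: le_trans (prU_le (measurableI _ _ mE mY) (measurable_sd mX mY)).
  apply: pr_le; [exact: measurableI|by apply: measurableU; [exact: measurableI|exact: measurable_sd]|].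
  move=> w /= [Ew Xw]; have [y|y] := pselect (Y w); [by left|right].
  by rewrite /sd /=; tauto.
have := h A B mA mB; have := h B A mB mA; rewrite [sd B A]sdC => h1 h2.
by rewrite ler_norml; apply/andP; split; lra.
Qed.

Lemma pr_sd A B : measurable A -> measurable B -> `|pr A - pr B| <= pr (sd A B).
Proof.
by move=> mA mB; have := pr_sd_setI mA mB measurableT; rewrite !setTI.
Qed.

End RealProbability.

(** * From approximately compatible permutations to a measure preserving system *)

Section Tower.
Context (R : realType) (d : measure_display) (Om : measurableType d).
Context (P : probability Om R).
Variables (N W : nat -> nat) (fl : nat -> int -> nat -> nat).
Variables (pi : nat -> nat -> nat) (Z : nat -> Om -> nat).
Hypothesis N0 : forall k, (0 < N k)%N.
Hypothesis flN : forall k n x, (x < N k)%N -> (fl k n x < N k)%N.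
Hypothesis fl0 : forall k x, fl k 0 x = x.
Hypothesis flD : forall k m n x, fl k (m + n) x = fl k m (fl k n x).
Hypothesis ZN : forall k w, (Z k w < N k)%N.
Hypothesis mZ : forall k y, measurable [set w | Z k w = y].
Hypothesis unifZ : forall k y, (y < N k)%N -> pr P [set w | Z k w = y] = (N k)%:R^-1.
Hypothesis piZ : forall k w, pi k (Z k.+1 w) = Z k w.
Hypothesis W_mono : forall k, (W k <= W k.+1)%N.
(** The errors are summable over the levels, and the slack [k] eventually exceeds any fixed [J]. *)
Hypothesis errZ : forall k n, (`|n| <= W k + k)%N ->
  pr P [set w | pi k (fl k.+1 n (Z k.+1 w)) != fl k n (Z k w)] <= 2^-1 ^+ k.

Notation pr := (pr P).

Definition ev k (B : pred nat) : set Om := [set w | B (Z k w)].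

Lemma measurable_ev k B : measurable (ev k B).
Proof.
rewrite (_ : ev k B = \bigcup_(y in [set y | B y]) [set w | Z k w = y]).
  exact: bigcup_measurable.
apply/seteqP; split => w /=; first by move=> h; exists (Z k w).
by case=> y /= By; rewrite /ev /= => ->.
Qed.
Local Hint Resolve measurable_ev : core.

Lemma pr_setI_ev E k B : measurable E ->
  pr (E `&` ev k B) = \sum_(y < N k) (B y)%:R * pr (E `&` [set w | Z k w = y]).
Proof.
move=> mE.
have H M : pr (E `&` ev k (fun y => B y && (y < M)%N)) =
    \sum_(y < M) (B y)%:R * pr (E `&` [set w | Z k w = y]).
  elim: M => [|M IH].
    rewrite big_ord0 (_ : _ `&` _ = set0) ?/pr ?measure0 //.
    by apply/seteqP; split => w //= [_]; rewrite /ev /= ltn0 andbF.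
  rewrite big_ord_recr -IH /=.
  have -> : E `&` ev k (fun y => B y && (y < M.+1)%N) =
     (E `&` ev k (fun y => B y && (y < M)%N)) `|`
     (E `&` [set w | B M /\ Z k w = M]).
    apply/seteqP; split => w /=; rewrite /ev /=.
      move=> [Ew /andP[Bw]]; rewrite ltnS leq_eqVlt => /orP[/eqP e|h].
        by right; split => //; rewrite -e.
      by left; rewrite Bw h.
    move=> [[Ew /andP[-> h]]|[Ew [BM ->]]]; first by rewrite ltnS ltnW.
    by rewrite BM ltnSn.
  rewrite prU ?IH //=; last first.
  - by apply/seteqP; split => w //= [[_]]; rewrite /ev /= => /andP[_ h] [_ [_ e]]; move: h; rewrite e ltnn.
  - by apply: measurableI => //; case: (boolP (B M)) => b;
      [rewrite (_ : [set w | _] = [set w | Z k w = M]) //|rewrite (_ : [set w | _] = set0) //];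
      apply/seteqP; split => w //= [].
  - exact: measurableI.
  congr (_ + _); case: (boolP (B M)) => b /=.
    by rewrite mul1r; congr pr; apply/seteqP; split => w /= [? //] [].
  by rewrite mul0r (_ : _ `&` _ = set0) ?/pr ?measure0 //; apply/seteqP; split => w //= [_ []].
rewrite -H; congr pr; congr (_ `&` _).
by apply/seteqP; split => w; rewrite /ev /= ZN andbT.
Qed.

Lemma pr_ev k B : pr (ev k B) = (\sum_(y < N k) (B y)%:R) / (N k)%:R.
Proof.
rewrite -[ev k B]setTI pr_setI_ev // mulr_suml; apply: eq_bigr => y _.
by rewrite setTI unifZ.
Qed.

Lemma pr_ev_fl k n B : pr (ev k (B \o fl k n)) = pr (ev k B).
Proof.
rewrite !pr_ev; congr (_ / _); apply: (sum_flow (fun x => (B x)%:R)).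
  by move=> m x; exact: flN.
by move=> m x _; rewrite -flD addNr fl0.
Qed.

Definition Tn (n : int) (z : nat -> nat) : nat -> nat := fun k => fl k n (z k).

Lemma Tn0 z : Tn 0 z = z.
Proof. by apply/funext => k; rewrite /Tn fl0. Qed.

Lemma TnD m n z : Tn (m + n) z = Tn m (Tn n z).
Proof. by apply/funext => k; rewrite /Tn flD. Qed.

Definition levels w : nat -> nat := fun k => Z k w.

Definition pre n (A : set (nat -> nat)) : set Om := [set w | A (Tn n (levels w))].

(* The sets that are approximated by events of level k along orbits of length
   W k. They form a sigma-algebra on which the law of the sequence (Z k)_k is
   Tn-invariant. *)
Definition tame : set (set (nat -> nat)) := [set A |
  (forall n, measurable (pre n A)) /\
  forall J (eps : R), 0 < eps -> exists k0, forall k, (k0 <= k)%N ->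
    exists B : pred nat, forall n, (`|n| <= W k + J)%N ->
      pr (sd (pre n A) (ev k (B \o fl k n))) <= eps].

Lemma tame_measurable A n : tame A -> measurable (pre n A).
Proof. by case. Qed.
Local Hint Resolve tame_measurable : core.

Lemma tame0 : tame set0.
Proof.
split => [n|J eps e0]; first by rewrite (_ : pre n set0 = set0).
exists 0%N => k _; exists pred0 => n _.
rewrite (_ : sd _ _ = set0) ?/pr ?measure0 ?ltW //.
by apply/seteqP; split => w //; rewrite /sd /pre /ev /=; apply; split.
Qed.

Lemma tameC A : tame A -> tame (~` A).
Proof.
move=> [mA hA]; split => [n|J eps e0].
  by rewrite (_ : pre n _ = ~` pre n A) //; exact: measurableC.
have [k0 hk] := hA J eps e0; exists k0 => k /hk[B hB].
exists (predC B) => n /hB; congr (pr _ <= _).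
apply/seteqP; split => w; rewrite /sd /pre /ev /=;
  have [a|a] := pselect (A (Tn n (levels w))); case: (B _) => /=; intuition.
Qed.

Lemma tameU A A' : tame A -> tame A' -> tame (A `|` A').
Proof.
move=> [mA hA] [mA' hA']; split => [n|J eps e0].
  by rewrite (_ : pre n _ = pre n A `|` pre n A') //; exact: measurableU.
have e2 : 0 < eps / 2 by rewrite divr_gt0.
have [k0 hk] := hA J _ e2; have [k1 hk'] := hA' J _ e2.
exists (maxn k0 k1) => k; rewrite geq_max => /andP[/hk[B hB] /hk'[B' hB']].
exists (predU B B') => n hn.
have m1 := measurable_sd (mA n) (measurable_ev k (B \o fl k n)).
have m2 := measurable_sd (mA' n) (measurable_ev k (B' \o fl k n)).
rewrite (splitr eps); apply: le_trans (lerD (hB n hn) (hB' n hn)).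
apply: le_trans (prU_le P m1 m2); apply: pr_le.
- exact: measurable_sd (measurableU _ _ (mA n) (mA' n)) _.
- exact: measurableU.
move=> w; have [h|h] := pselect (A (Tn n (levels w)) <-> B (fl k n (Z k w))); last by left.
have [h' hh|h' _] := pselect (A' (Tn n (levels w)) <-> B' (fl k n (Z k w))); last by right.
apply: contrapT => _; apply: hh; rewrite /pre /ev /=; split.
  by case=> [/h ->|/h' ->]; rewrite ?orbT.
by case/orP => [/h|/h']; [left|right].
Qed.

(** On a single level [fl k n] preserves the uniform law exactly, and both sides are close to the
    probability of one level event. The slack [J = |n|] brings the time [n] into the window. *)
Lemma pr_pre A n : tame A -> pr (pre n A) = pr (pre 0 A).
Proof.
move=> [mA hA]; apply/eqP; rewrite -subr_eq0 -normr_le0; apply/ler_addgt0Pr => e e0.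
have e2 : 0 < e / 2 by rewrite divr_gt0.
have [k0 /(_ k0 (leqnn _))[B hB]] := hA `|n|%N _ e2.
have h1 : `|pr (pre n A) - pr (ev k0 B)| <= e / 2.
  by rewrite -(pr_ev_fl k0 n); apply: le_trans (pr_sd P _ _) (hB _ _) => //; lia.
have h2 : `|pr (pre 0 A) - pr (ev k0 B)| <= e / 2.
  by rewrite -(pr_ev_fl k0 0); apply: le_trans (pr_sd P _ _) (hB _ _) => //; lia.
by move: h1 h2; rewrite add0r !ler_norml => /andP[? ?] /andP[? ?]; apply/andP; split; lra.
Qed.

(** The delicate point is that the approximation must be uniform over a growing window of times. The
    finite unions [V M] exhaust [U] up to a small probability at time 0, and by invariance the
    missing probability is the same at every time. *)
Lemma tame_bigcup (A : nat -> set (nat -> nat)) :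
  (forall i, tame (A i)) -> tame (\bigcup_i A i).
Proof.
move=> hA; set U := \bigcup_i A i.
pose V M : set (nat -> nat) := [set z | exists2 i, (i < M)%N & A i z].
have tV M : tame (V M).
  elim: M => [|M IH].
    rewrite (_ : V 0%N = set0); first exact: tame0.
    by apply/seteqP; split => z // -[].
  rewrite (_ : V M.+1 = V M `|` A M); first exact: tameU.
  apply/seteqP; split => z /=.
    move=> [i]; rewrite ltnS leq_eqVlt => /orP[/eqP ->|iM] Az; [by right|left].
    by exists i.
  by move=> [[i iM Az]|Az]; [exists i => //; exact: ltnW|exists M].
have UE n : pre n U = \bigcup_M pre n (V M).
  apply/seteqP; split => w.
    by move=> [i _ Ai]; exists i.+1 => //; exists i.
  by move=> [M _ [i _ Ai]]; exists i.
have mU n : measurable (pre n U).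
  by rewrite UE; apply: bigcup_measurable => M _; exact: tame_measurable.
have cU n : (fun M => pr (pre n (V M))) @ \oo --> pr (pre n U).
  rewrite UE; apply: pr_bigcup_cvg => [M|]; first exact: tame_measurable.
  by move=> M M' MM'; apply/subsetPset => w [i iM Ai]; exists i => //; exact: leq_trans MM'.
(* [U] is not yet known to be tame, so its invariance is obtained as the limit of that of the
   [V M]. *)
have prU0 n : pr (pre n U) = pr (pre 0 U).
  have e : (fun M => pr (pre n (V M))) = (fun M => pr (pre 0 (V M))).
    by apply/funext => M; exact: pr_pre.
  by have := cU n; rewrite e => c; exact: (cvg_unique _ c (cU 0)).
split => // J eps e0.
have e2 : 0 < eps / 2 by rewrite divr_gt0.
have [M hM] : exists M, pr (pre 0 U) - pr (pre 0 (V M)) <= eps / 2.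
  have /cvgrPdist_le /(_ _ e2) [M _ /(_ M (leqnn M)) hM] := cU 0.
  by exists M; apply: le_trans hM; exact: ler_norm.
have [k0 hk] := (tV M).2 J _ e2; exists k0 => k /hk[B hB]; exists B => n hn.
rewrite (splitr eps); have mV : measurable (pre n (V M)) by exact: tame_measurable.
apply: le_trans (pr_sd_triangle P (mU n) mV _) _ => //.
apply: lerD (hB n hn).
have VU : pre n (V M) `<=` pre n U by move=> w [i _ Ai]; exists i.
rewrite (_ : sd _ _ = pre n U `\` pre n (V M)).
  by rewrite prD // ?prU0 ?(pr_pre n (tV M)) //; exact: tame_measurable.
by rewrite sdE; apply/seteqP; split => w /= ; [move=> [|[/VU]]|left].
Qed.

(** The shift by [m] is absorbed by enlarging the slack; this is one reason why [tame] quantifies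
    over [J]. *)
Lemma tame_Tn A m : tame A -> tame (Tn m @^-1` A).
Proof.
move=> [mA hA].
have preE n : pre n (Tn m @^-1` A) = pre (m + n) A.
  by rewrite /pre /preimage /=; apply/seteqP; split => w /=; rewrite TnD.
split => [n|J eps e0]; first by rewrite preE.
have [k0 hk] := hA (J + `|m|)%N _ e0; exists k0 => k /hk[B hB].
exists (B \o fl k m) => n hn; rewrite preE.
have := hB (m + n); rewrite (_ : _ \o _ = (B \o fl k m) \o fl k n).
  by apply; lia.
by apply/funext => x /=; rewrite flD.
Qed.

Lemma tame_sigma_algebra : sigma_algebra setT tame.
Proof.
split; [exact: tame0|by move=> A hA; rewrite setTD; exact: tameC|exact: tame_bigcup].
Qed.

Notation X := (g_sigma_algebraType tame).

Lemma measurable_tame : (measurable : set (set X)) = tame.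
Proof. exact: measurable_g_measurableTypeE tame_sigma_algebra. Qed.

Definition Zpath : Om -> X := levels.

Lemma pre0E A : pre 0 A = Zpath @^-1` A.
Proof. by apply/seteqP; split => w; rewrite /pre /= Tn0. Qed.

Lemma measurable_Zpath : measurable_fun setT Zpath.
Proof.
by move=> _ A; rewrite measurable_tame => tA; rewrite setTI -pre0E; exact: tame_measurable.
Qed.

HB.instance Definition _ := isMeasurableFun.Build _ _ _ _ Zpath measurable_Zpath.

Definition tower_law : probability X R := distribution P Zpath.

Lemma tower_lawE A : tower_law A = P (pre 0 A).
Proof. by rewrite pre0E. Qed.

Lemma measurable_Tn n : measurable_fun setT (Tn n : X -> X).
Proof.
by move=> _ A; rewrite !measurable_tame => tA; rewrite setTI; exact: tame_Tn.
Qed.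

Lemma iter_Tn m z : iter m (Tn 1) z = Tn m z.
Proof.
elim: m => [|m IH]; first by rewrite Tn0.
by rewrite iterS IH -TnD; congr Tn; lia.
Qed.

Lemma Tpow_Tn n z : Tpow (Tn 1) (Tn (-1)) n z = Tn n z.
Proof.
case: n => m; first exact: iter_Tn.
elim: m => [//|m IH]; rewrite /= in IH *; rewrite IH -TnD; congr Tn; lia.
Qed.

Lemma tower_mps : mps tower_law (Tn 1 : X -> X) (Tn (-1) : X -> X).
Proof.
split; [exact: measurable_Tn|exact: measurable_Tn| | |].
- by move=> z; rewrite -TnD addNr Tn0.
- by move=> z; rewrite -TnD subrr Tn0.
move=> A; rewrite measurable_tame => tA; rewrite !tower_lawE.
have -> : pre 0 ((Tn 1 : X -> X) @^-1` A) = pre 1 A.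
  by apply/seteqP; split => w; rewrite /pre /= Tn0.
transitivity (pr (pre 1 A))%:E; first by apply: prE; exact: tame_measurable.
rewrite pr_pre //; apply/esym/prE; exact: tame_measurable.
Qed.

(** At the level belonging to a large [n], the set [D] is close to one level event both at time 0
    and at time [- n], and that event changes only at points moved by [fl k.+1 n]. *)
Lemma tower_rigidity (S : set int) (b J : nat) :
  ~ finite_set S ->
  (forall n, S n -> exists k, (`|n| <= W k.+1 + J)%N /\
     ((b <= k)%N -> pr [set w | fl k.+1 n (Z k.+1 w) != Z k.+1 w] <= k.+1%:R^-1)) ->
  set_of_rigidity tower_law (Tn 1 : X -> X) (Tn (-1) : X -> X) S.
Proof.
move=> infS hS; split => // D mD eps e0.
have tD : tame D by rewrite -measurable_tame.
have e3 : 0 < eps / 3 by rewrite divr_gt0.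
have [k0 hk] := tD.2 J _ e3.
pose K := maxn k0 (maxn b (Num.bound (3 / eps))).
have Wm : {homo W : i j / (i <= j)%N}.
  move=> i j; elim: j => [|j IH]; first by rewrite leqn0 => /eqP ->.
  by rewrite leq_eqVlt => /predU1P[->//|/IH h]; exact: leq_trans h (W_mono j).
pose M := (W K + J)%N.
apply: (@sub_finite_set _ _ [set n : int | (`|n| <= M)%N]); last first.
  apply: (@sub_finite_set _ _ ((fun i : nat => i%:Z - M%:Z) @` `I_(M + M).+1)).
    move=> n /= nM; exists `|(n + M%:Z)%R|%N; lia.
  exact/finite_image/finite_II.
move=> n /= [Sn]; apply: contraPT; rewrite -ltnNge => nM; apply/negP; rewrite -leNgt.
have [k [nW hrig]] := hS n Sn.
(* Times whose level is below [K] lie in the window of level [K] by monotonicity of [W], so they are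
   finitely many. *)
have Kk : (K <= k)%N.
  rewrite leqNgt; apply/negP => kK; move: nM; rewrite ltnNge => /negP; apply.
  by apply: leq_trans nW _; rewrite leq_add2r Wm.
have := Kk; rewrite /K !geq_max => /and3P[k0k bk ek].
have [B hB] := hk k.+1 (leqW k0k).
have mev n' : measurable (ev k.+1 (B \o fl k.+1 n')) by exact: measurable_ev.
have mpre n' : measurable (pre n' D) by exact: tame_measurable.
have tower := tower_mps.
rewrite (TimgE tower) tower_lawE.
have -> : pre 0 (symdiff D (Tpow (Tn 1 : X -> X) (Tn (-1)) (- n) @^-1` D)) =
    sd (pre 0 D) (pre (- n) D).
  rewrite sdE; apply/seteqP; split => w; rewrite /pre /symdiff /= Tpow_Tn Tn0 //.
rewrite prE ?lee_fin; last exact: measurable_sd.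
have -> : eps = eps / 3 + (eps / 3 + eps / 3) by field.
apply: le_trans (pr_sd_triangle P (mpre 0) (mev 0) (mpre (- n))) _.
apply: lerD; first by apply: hB; lia.
apply: le_trans (pr_sd_triangle P (mev 0) (mev (- n)) (mpre (- n))) _.
apply: lerD; last by rewrite sdC; apply: hB; lia.
have mfix : measurable [set w | fl k.+1 n (Z k.+1 w) != Z k.+1 w].
  exact: (measurable_ev k.+1 (fun y => fl k.+1 n y != y)).
apply: le_trans (_ : pr [set w | fl k.+1 n (Z k.+1 w) != Z k.+1 w] <= _).
  apply: pr_le => //; first exact: measurable_sd.
  move=> w; rewrite /sd /ev /= fl0 => h; apply/eqP => e; apply: h.
  by rewrite -{2}e -flD addNr fl0.
apply: le_trans (hrig bk) _.
rewrite -[eps / 3]invrK lef_pV2 ?posrE ?invr_gt0 // invf_div.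
have := archi_boundP (ltW (divr_gt0 (ltr0n R 3) e0)) => /ltW h.
by apply: le_trans h _; rewrite ler_nat leqW.
Qed.

Lemma sd_ev k A B : sd (ev k A) (ev k B) = ev k (fun y => A y (+) B y).
Proof.
apply/seteqP; split => w; rewrite /sd /ev /=; have [a|a] := boolP (A (Z k w)); have [b|b] := boolP (B (Z k w)) => //=.
- by case; split.
- by case; split.
- by move=> _ [/(_ isT)].
- by move=> _ [_ /(_ isT)].
Qed.

Definition corr k (B : pred nat) (n : int) : R :=
  (\sum_(y < N k.+1) (B (pi k y) && B (pi k (fl k.+1 n y)))%:R) / (N k.+1)%:R.

Lemma sum_fl k (F : nat -> R) n : \sum_(y < N k) F (fl k n y) = \sum_(y < N k) F y.
Proof.
have flK m x : (x < N k)%N -> fl k (- m) (fl k m x) = x by rewrite -flD addNr fl0.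
exact: (sum_flow F n (@flN k) flK).
Qed.

Lemma ev_pi k B : ev k.+1 (B \o pi k) = ev k B.
Proof. by apply/seteqP; split => w; rewrite /ev /= piZ. Qed.

(* As q does not depend on E, shifting E gives the same bound on every window
   of q consecutive times. *)
Lemma tower_block_mixing (b : nat) (Q : nat -> nat) (eta : nat -> R)
    (B : set (nat -> nat)) (e : R) :
  (forall k, (b <= k)%N -> (0 < Q k <= W k.+1)%N) ->
  (forall k C n0, (b <= k)%N -> \sum_(m < Q k)
     (corr k C (m%:Z - n0) - density R (N k) C ^+ 2) ^+ 2 <= (Q k)%:R * eta k) ->
  (forall x, 0 < x -> exists k0, forall k, (k0 <= k)%N -> eta k <= x) ->
  tame B -> 0 < e ->
  exists2 q, (0 < q)%N & forall E, measurable E ->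
    \sum_(n < q) `|pr (E `&` pre n%:Z B) - pr E * pr (pre 0 B)| <= q%:R * e.
Proof.
move=> hQ hcorr heta tB e0.
(* Five errors: one from the main term, three from replacing [B] by [F] along the orbit, one from
   replacing its probability by [beta]. The fourth power pays for two passages from squares to
   absolute values, in [sum_norm_le_sqr] and in [weighted_correlation_bound]. *)
pose x := e / 5; have x0 : 0 < x by rewrite divr_gt0.
have x4 : 0 < (x ^+ 2) ^+ 2 by rewrite !exprn_gt0.
have [k0 hk0] := tB.2 0%N _ x0; have [k1 hk1] := heta _ x4.
pose k := maxn b (maxn k0 k1).
have /and3P[bk k0k k1k] : [&& (b <= k)%N, (k0 <= k)%N & (k1 <= k)%N].
  by rewrite /k !leq_max !leqnn !orbT.
have /andP[Q0 QW] := hQ k bk; exists (Q k) => // E mE.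
have [Bk hBk] := hk0 k k0k; have [B' hB'] := hk0 k.+1 (leqW k0k).
(* The variance bound concerns level-[k] events read on level [k.+1], whereas over the long window
   [Q k] tameness provides the level-[k.+1] event [B']. The two are compared at time 0, and
   [fl k.+1 n] preserves their distance. *)
pose F := Bk \o pi k.
have mpre n : measurable (pre n B) by exact: tame_measurable.
have hF (n : nat) : (n < Q k)%N -> pr (sd (pre n%:Z B) (ev k.+1 (F \o fl k.+1 n%:Z))) <= x + (x + x).
  move=> nQ; have mB' := measurable_ev k.+1 (B' \o fl k.+1 n%:Z).
  apply: le_trans (pr_sd_triangle P (mpre n%:Z) mB' (measurable_ev _ _)) _.
  apply: lerD; first by apply: hB'; rewrite addn0 /=; apply: leq_trans (ltnW nQ) QW.
  rewrite sd_ev -[X in pr (ev _ X)]/((fun y => B' y (+) F y) \o fl k.+1 n%:Z).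
  rewrite pr_ev_fl -sd_ev ev_pi.
  apply: le_trans (pr_sd_triangle P (measurable_ev _ _) (mpre 0) (measurable_ev _ _)) _.
  have id0 j (C : pred nat) : C \o fl j 0 = C by apply/funext => y /=; rewrite fl0.
  apply: lerD; first by rewrite sdC -(id0 k.+1 B'); exact: hB'.
  by rewrite -(id0 k Bk); exact: hBk.
pose beta := pr (ev k Bk).
have hbeta : `|pr (pre 0 B) - beta| <= x.
  apply: le_trans (pr_sd P (mpre 0) (measurable_ev _ _)) _.
  have -> : Bk = Bk \o fl k 0 by apply/funext => y /=; rewrite fl0.
  exact: hBk.
have betaE : beta = density R (N k) Bk by rewrite /beta pr_ev.
pose al y := pr (E `&` [set w | Z k.+1 w = y]).
pose h (n y : nat) : R := (F (fl k.+1 n%:Z y))%:R - beta.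
have NR : 0 < (N k.+1)%:R :> R by rewrite ltr0n.
have mean n : \sum_(y < N k.+1) (F (fl k.+1 n y))%:R = (N k.+1)%:R * beta.
  rewrite (sum_fl k.+1 (fun y => (F y)%:R)) /beta -ev_pi pr_ev mulrCA divff ?mulr1 //.
  by rewrite gt_eqF.
have prEE : pr E = \sum_(y < N k.+1) al y.
  have := pr_setI_ev k.+1 predT mE; rewrite (_ : ev _ _ = setT) ?setIT.
    by move=> ->; apply: eq_bigr => y _; rewrite mul1r.
  by apply/seteqP; split.
have hal y : (y < N k.+1)%N -> 0 <= al y <= (N k.+1)%:R^-1.
  move=> yN; rewrite pr_ge0 /= -(unifZ yN); apply: pr_le => //; exact: measurableI.
have hEn (n : nat) : pr (E `&` ev k.+1 (F \o fl k.+1 n%:Z)) - pr E * beta =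
    \sum_(y < N k.+1) al y * h n y.
  rewrite pr_setI_ev // prEE mulr_suml -sumrB; apply: eq_bigr => y _.
  by rewrite /h mulrBr mulrC.
have hmain : \sum_(n < Q k) `|\sum_(y < N k.+1) al y * h n y| <= (Q k)%:R * x.
  apply: weighted_correlation_bound => // n nQ.
  have hh m : (\sum_(y < N k.+1) h n y * h m y) / (N k.+1)%:R =
      corr k Bk (m%:Z - n%:Z) - density R (N k) Bk ^+ 2.
    have -> : corr k Bk (m%:Z - n%:Z) =
        (\sum_(y < N k.+1) (F (fl k.+1 n%:Z y) && F (fl k.+1 m%:Z y))%:R) / (N k.+1)%:R.
      congr (_ / _); rewrite -(sum_fl k.+1 (fun y => (Bk (pi k y) && Bk (pi k (fl k.+1 (m%:Z - n%:Z) y)))%:R) n%:Z).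
      by apply: eq_bigr => y _; rewrite -flD subrK.
    transitivity ((\sum_(y < N k.+1) ((F (fl k.+1 n%:Z y) && F (fl k.+1 m%:Z y))%:R
       - beta * (F (fl k.+1 n%:Z y))%:R - beta * (F (fl k.+1 m%:Z y))%:R + beta ^+ 2)) / (N k.+1)%:R).
      congr (_ / _); apply: eq_bigr => y _; rewrite /h -mulnb natrM; ring.
    rewrite big_split !sumrB /= sumr_const card_ord -(mulr_natl (beta ^+ 2)) -!mulr_sumr !mean -betaE.
    by field; rewrite gt_eqF.
  under eq_bigr => m _ do rewrite hh.
  apply: (sum_norm_le_sqr (f := fun m => corr k Bk (m%:Z - n%:Z) - density R (N k) Bk ^+ 2) (hcorr k Bk n%:Z bk)).
    exact: exprn_gt0.
  exact: hk1.
apply: le_trans (_ : \sum_(n < Q k) (`|\sum_(y < N k.+1) al y * h n y| + 4 * x) <= _).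
  apply: ler_sum => n _; rewrite -hEn.
  have h1 := pr_sd_setI P (mpre n%:Z) (measurable_ev k.+1 (F \o fl k.+1 n%:Z)) mE.
  have h2 := le_trans h1 (hF n (ltn_ord n)).
  have h3 : `|pr E * (pr (pre 0 B) - beta)| <= x.
    rewrite normrM; apply: le_trans hbeta; apply: ler_piMl => //.
    rewrite ger0_norm ?pr_ge0 // -lee_fin -prE //; exact: probability_le1.
  set u := pr (E `&` pre _ _) in h2 *; set v := pr (E `&` ev _ _) in h2 *.
  have -> : u - pr E * pr (pre 0 B) =
    (v - pr E * beta) + ((u - v) - pr E * (pr (pre 0 B) - beta)) by ring.
  apply: le_trans (ler_normD _ _) _; rewrite lerD2l.
  apply: le_trans (ler_normB _ _) _; apply: le_trans (lerD h2 h3) _; lra.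
rewrite big_split /= sumr_const card_ord -(mulr_natl (4 * x)).
apply: le_trans (lerD hmain (lexx _)) _; rewrite -mulrDr ler_wpM2l // /x; lra.
Qed.

Lemma tameI A A' : tame A -> tame A' -> tame (A `&` A').
Proof.
by move=> tA tA'; rewrite -[_ `&` _]setCK setCI; apply/tameC/tameU; exact: tameC.
Qed.

Lemma tower_weak_mixing (b : nat) (Q : nat -> nat) (eta : nat -> R) :
  (forall k, (b <= k)%N -> (0 < Q k <= W k.+1)%N) ->
  (forall k C n0, (b <= k)%N -> \sum_(m < Q k)
     (corr k C (m%:Z - n0) - density R (N k) C ^+ 2) ^+ 2 <= (Q k)%:R * eta k) ->
  (forall x, 0 < x -> exists k0, forall k, (k0 <= k)%N -> eta k <= x) ->
  weak_mixing tower_law (Tn 1 : X -> X).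
Proof.
move=> hQ hcorr heta A B; rewrite measurable_tame => tA tB.
pose c n := `|pr (pre 0 (A `&` Tn n @^-1` B)) - pr (pre 0 A) * pr (pre 0 B)|.
rewrite (_ : (fun M => _) = (fun M : nat => M%:R^-1 * \sum_(0 <= n < M) c n%:Z)); last first.
  apply/funext => M; congr (_ * _); apply: eq_bigr => n _; rewrite /c /pr -!tower_lawE.
  congr (`|fine (tower_law (_ `&` _)) - _|); apply/funext => z.
  by rewrite /preimage /= iter_Tn.
have cE s n : c (s + n) = `|pr (pre (- s) A `&` pre n B) - pr (pre (- s) A) * pr (pre 0 B)|.
  rewrite /c -(pr_pre (- s)); last by apply: tameI => //; exact: tame_Tn.
  rewrite (pr_pre (- s) tA); congr (`|pr _ - _|).
  apply/seteqP; split => w; rewrite /pre /preimage /= -TnD => -[h1 h2]; split => //; move: h2;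
    by congr (B (Tn _ _)); lia.
apply/cvgrPdist_le => e e0.
have e2 : 0 < e / 2 by rewrite divr_gt0.
have [q q0 hq] := tower_block_mixing hQ hcorr heta tB e2.
have block s : \sum_(r < q) c (s%:Z + r%:Z) <= q%:R * (e / 2).
  under eq_bigr => r _ do rewrite cE.
  by apply: hq; exact: tame_measurable.
near=> M.
have qM : (q <= M)%N by near: M; exact: nbhs_infty_ge.
have M0 : (0 < M)%N by exact: leq_trans qM.
have MR : 0 < M%:R :> R by rewrite ltr0n.
have c0 n : 0 <= c n by exact: normr_ge0.
rewrite sub0r normrN ger0_norm; last by rewrite mulr_ge0 ?invr_ge0 ?ler0n // sumr_ge0.
rewrite mulrC ler_pdivrMr // big_mkord.
(* Rounding up to full blocks of length [q] at most doubles the number of terms, hence the bound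
   [e / 2] per block. *)
have MM : (M <= (M %/ q).+1 * q)%N by rewrite ltnW // ltn_ceil.
apply: le_trans (_ : \sum_(n < (M %/ q).+1 * q) c n%:Z <= _).
  rewrite -!(big_mkord xpredT (fun n => c n%:Z)) (big_cat_nat (leq0n M) MM) /=.
  by rewrite lerDl sumr_ge0.
rewrite (sum_block _ _ (fun n => c n%:Z)).
apply: le_trans (_ : \sum_(i < (M %/ q).+1) q%:R * (e / 2) <= _).
  by apply: ler_sum => i _; under eq_bigr => r _ do rewrite PoszD; exact: block.
rewrite sumr_const card_ord -[leLHS]mulr_natl mulrA -natrM.
have h : ((M %/ q).+1 * q <= M + M)%N.
  by rewrite mulSn addnC leq_add // leq_trunc_div.
have : ((M %/ q).+1 * q)%:R <= M%:R + M%:R :> R by rewrite -natrD ler_nat.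
by move=> /(ler_wpM2r (ltW e2)); lra.
Unshelve. all: by end_near. Qed.

Fixpoint lift_pred k : pred nat :=
  if k is k'.+1 then lift_pred k' \o pi k' else pred1 0%N.

(** A condition on one coordinate need not be tame. The event [Z 0 w = 0] is therefore encoded by a
    tail condition: its lifts hold from some level on. On compatible sequences this is the same
    event, of probability 1/2. It is tame because, outside the errors of the levels from [k] on, all
    these lifts agree along the orbit, and the errors sum to at most [2 * 2^-k]. *)
Lemma tower_nontrivial : N 0 = 2%N -> nontrivial tower_law.
Proof.
move=> N2.
pose A : set (nat -> nat) := [set z | exists k0, forall k, (k0 <= k)%N -> lift_pred k (z k)].
pose err n j := [set w | pi j (fl j.+1 n (Z j.+1 w)) != fl j n (Z j w)].
have merr n j : measurable (err n j).
  rewrite (_ : err n j = ev j.+1 (fun y => pi j (fl j.+1 n y) != fl j n (pi j y))).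
    exact: measurable_ev.
  by apply/seteqP; split => w; rewrite /err /ev /= piZ.
have mA n : measurable (pre n A).
  rewrite (_ : pre n A = \bigcup_k0 \bigcap_(k in [set k | (k0 <= k)%N]) ev k (lift_pred k \o fl k n)).
    apply: bigcup_measurable => k0 _; apply: bigcap_measurable => //.
    by exists k0 => /=.
  apply/seteqP; split => w.
    by move=> [k0 h]; exists k0 => // k /h.
  by move=> [k0 _ h]; exists k0 => k /h.
have hsd n k : sd (pre n A) (ev k (lift_pred k \o fl k n)) `<=` \bigcup_j err n (k + j)%N.
  move=> w h; apply: contrapT => no; apply: h.
  have step j : lift_pred (k + j) (fl (k + j)%N n (Z (k + j)%N w)) = lift_pred k (fl k n (Z k w)).
    elim: j => [|j IH]; first by rewrite addn0.
    rewrite -IH addnS /=; congr (lift_pred _ _); apply/eqP.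
    by apply: contrapT => /negP ne; apply: no; exists j.
  split => [[k1 h]|h].
    by rewrite /ev /= -(step k1); apply: h; rewrite leq_addl.
  by exists k => k' kk'; rewrite -(subnKC kk') /Tn /levels step.
have tA : tame A.
  split => // J eps e0.
  have /cvgrPdist_le/(_ _ e0)[k1 _ hk1] : (fun k => 2 * 2^-1 ^+ k : R) @ \oo --> (0 : R).
    rewrite -[X in _ --> X](mulr0 2); apply: cvgMr; apply: cvg_expr.
    by rewrite ger0_norm; lra.
  exists (maxn J k1) => k; rewrite geq_max => /andP[Jk k1k].
  exists (lift_pred k) => n hn.
  have := hk1 k k1k; rewrite sub0r normrN ger0_norm => [|]; last by rewrite mulr_ge0 // exprn_ge0.
  apply: le_trans.
  have msd : measurable (sd (pre n A) (ev k (lift_pred k \o fl k n))).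
    by apply: measurable_sd => //; exact: measurable_ev.
  rewrite -lee_fin -prE //.
  apply: le_trans (measure_sigma_subadditive P (fun j => merr n (k + j)%N) msd (hsd n k)) _.
  have k20 : 0 <= 2 * 2^-1 ^+ k :> R by rewrite mulr_ge0 // exprn_ge0.
  apply: le_trans (epsilon_trick0 xpredT k20).
  apply: lee_nneseries => [j _|j _]; first by move=> *; exact: measure_ge0.
  have Wm i : (W k <= W (k + i))%N.
    by elim: i => [|i IH]; rewrite ?addn0 // addnS (leq_trans IH).
  have hn' : (`|n| <= W (k + j) + (k + j))%N by move: (Wm j) hn Jk; lia.
  have := errZ hn'; rewrite -lee_fin -(prE P (merr n (k + j)%N)) => h.
  apply: le_trans h _; rewrite lee_fin.
  rewrite natrX -exprVn exprD exprSr le_eqVlt; apply/orP; left; apply/eqP.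
  by field.
have hP : tower_law A = (2^-1)%:E.
  rewrite tower_lawE prE //; congr (_%:E).
  rewrite (_ : pre 0 A = ev 0 (pred1 0%N)).
    by rewrite pr_ev N2 big_ord_recl big_ord1 /= addr0 mul1r.
  have l0 k w : lift_pred k (Z k w) = (Z 0%N w == 0%N).
    by elim: k => [//|k IH]; rewrite /= piZ.
  apply/seteqP; split => w; rewrite /pre /ev /A /= Tn0 /levels.
    by move=> [k0 /(_ k0 (leqnn _))]; rewrite l0.
  by move=> h; exists 0%N => k _; rewrite l0.
by exists A; rewrite measurable_tame hP !lte_fin; split => //; lra.
Qed.

End Tower.

(** * The parameters: numbers of blocks, cycle lengths, windows *)

(* Two sets of density 1/K in the product of K * (2 K^5) cyclic groups have
   Hamming distance at most 2 K^4, which is 1/K of the 2 K^5 blocks of a single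
   system. *)
Definition par_d (k : nat) : nat := (2 * k.+1 ^ 5)%N.
Definition par_D (k : nat) : nat := (k.+1 * par_d k)%N.
Definition par_t (k : nat) : nat := (1 + par_D k * (par_D k)`!)%N.

(** Coprimality of the cycle lengths needs the factorial to divide [L]. The other factor makes the
    error of [stepflow_error], at most [N * (2 * (W + k) + t)] per block, a proportion [2^-k] of
    [L = N * a]. *)
Definition next_a (k W : nat) : nat :=
  ((par_D k)`! * (2 ^ k * (2 * (W + k) + par_t k)))%N.

(* The cycle lengths of one step are pairwise coprime: a common prime factor
   divides (par_D k)`!, hence L, hence 1 + j * (par_D k)`!. *)
Definition cycle_len (k L j : nat) : nat := (L - (1 + j * (par_D k)`!))%N.

Definition cycle_lens (k L : nat) : seq nat := mkseq (cycle_len k L) (par_D k).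

(** Sizes and windows are defined together since [a] depends on the window. The window [2 * Q + k]
    holds a full period [Q] for mixing, the times in [Q, 2Q) that make [S] unbounded, and the
    differences of visit times shifted by some [m] with [|m| <= k]. *)
Fixpoint par_NW (k : nat) : nat * nat :=
  if k is k'.+1 then
    let L := ((par_NW k').1 * next_a k' (par_NW k').2)%N in
    ((par_d k' * L)%N, (2 * seqprod (cycle_lens k' L) + k')%N)
  else (2%N, 0%N).

Definition par_N k := (par_NW k).1.
Definition par_W k := (par_NW k).2.
Definition par_a k := next_a k (par_W k).
Definition par_L k := (par_N k * par_a k)%N.
Definition par_qs k := cycle_lens k (par_L k).
Definition par_Q k := seqprod (par_qs k).

Arguments par_d : simpl never.
Arguments par_D : simpl never.
Arguments par_N : simpl never.
Arguments par_W : simpl never.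
Arguments par_a : simpl never.
Arguments par_L : simpl never.
Arguments par_qs : simpl never.
Arguments par_Q : simpl never.

Lemma par_NS k : par_N k.+1 = (par_d k * par_L k)%N. Proof. by []. Qed.
Lemma par_WS k : par_W k.+1 = (2 * par_Q k + k)%N. Proof. by []. Qed.

Lemma par_d_gt0 k : (0 < par_d k)%N.
Proof. by rewrite /par_d muln_gt0 expn_gt0. Qed.

Lemma par_a_ge k : (2 ^ k * (2 * (par_W k + k) + par_t k) <= par_a k)%N.
Proof. by rewrite /par_a /next_a leq_pmull // fact_gt0. Qed.

Lemma par_a_get k : (2 * (par_W k + k) + par_t k <= par_a k)%N.
Proof. by apply: leq_trans (par_a_ge k); rewrite leq_pmull // expn_gt0. Qed.

Lemma par_a_gt0 k : (0 < par_a k)%N.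
Proof. by apply: leq_trans (par_a_get k); rewrite /par_t; lia. Qed.

Lemma par_N_ge2 k : (2 <= par_N k)%N.
Proof.
elim: k => [//|k IH]; rewrite par_NS /par_L.
apply: leq_trans IH _; rewrite mulnC -mulnA leq_pmulr //.
by rewrite muln_gt0 par_a_gt0 par_d_gt0.
Qed.

Lemma par_N_gt0 k : (0 < par_N k)%N.
Proof. exact: leq_trans (par_N_ge2 k). Qed.

Lemma par_L_gt k : (par_W k + par_t k < par_L k)%N.
Proof.
have := par_a_get k; have := leq_mul (par_N_ge2 k) (leqnn (par_a k)).
by rewrite -/(par_L k) /par_t; lia.
Qed.

Lemma cycle_len_bounds k j : (j < par_D k)%N ->
  [/\ (0 < cycle_len k (par_L k) j)%N, (cycle_len k (par_L k) j <= par_L k)%N &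
      (par_L k <= cycle_len k (par_L k) j + par_t k)%N].
Proof.
move=> jD; have := par_L_gt k.
have : (j * (par_D k)`! <= par_D k * (par_D k)`!)%N by rewrite leq_mul2r (ltnW jD) orbT.
by rewrite /cycle_len /par_t => h1 h2; split; lia.
Qed.

Lemma block_index_lt k b i : (b <= k)%N -> (i < par_d k)%N ->
  (b * par_d k + i < par_D k)%N.
Proof.
move=> bk id; apply: (@leq_trans (b.+1 * par_d k)).
  by rewrite mulSn addnC ltn_add2r.
by rewrite /par_D leq_mul2r ltnS bk orbT.
Qed.

Lemma mem_par_qs k j : (j < par_D k)%N -> cycle_len k (par_L k) j \in par_qs k.
Proof. by move=> jD; apply/mapP; exists j; rewrite // mem_iota. Qed.

Lemma par_qs_coprime k : pairwise_coprime (par_qs k).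
Proof.
apply/(pairwiseP 0%N) => i j; rewrite !inE /par_qs size_mkseq => iD jD ij.
rewrite !nth_mkseq //.
have [qi _ _] := cycle_len_bounds iD; have [qj _ _] := cycle_len_bounds jD.
apply: contraT => nc.
set g := gcdn (cycle_len k (par_L k) i) (cycle_len k (par_L k) j).
have g1 : (1 < g)%N.
  by rewrite ltn_neqAle eq_sym -/(coprime _ _) nc gcdn_gt0 qi.
have pp := pdiv_prime g1; set p := pdiv g in pp.
have pg : (p %| g)%N by exact: pdiv_dvd.
have pi_ : (p %| cycle_len k (par_L k) i)%N := dvdn_trans pg (dvdn_gcdl _ _).
have pj_ : (p %| cycle_len k (par_L k) j)%N := dvdn_trans pg (dvdn_gcdr _ _).
have pD : (p %| (par_D k)`!)%N.
  have : (p %| cycle_len k (par_L k) i - cycle_len k (par_L k) j)%N by rewrite dvdn_sub.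
  have -> : (cycle_len k (par_L k) i - cycle_len k (par_L k) j = (j - i) * (par_D k)`!)%N.
    by rewrite mulnBl; move: qi qj; rewrite /cycle_len; lia.
  rewrite Euclid_dvdM // => /orP[h|//]; apply: dvdn_trans h _; apply: dvdn_fact.
  by lia.
have pL : (p %| par_L k)%N.
  by rewrite /par_L dvdn_mull // /par_a /next_a dvdn_mulr.
have : (p %| 1 + i * (par_D k)`!)%N.
  rewrite -(dvdn_addr _ pi_) subnK //; move: qi; rewrite /cycle_len; lia.
by rewrite (dvdn_addl 1 (dvdn_mull i pD)) dvdn1 => /eqP p1; rewrite p1 in pp.
Qed.

Lemma par_qs_gt0 k : all (leq 1) (par_qs k).
Proof.
apply/allP => q /mapP[j]; rewrite mem_iota add0n => /andP[_ jD] ->.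
by have [] := cycle_len_bounds jD.
Qed.

Lemma par_Q_ge k : (par_W k + k <= par_Q k)%N.
Proof.
have D0 : (0 < par_D k)%N by rewrite muln_gt0 par_d_gt0.
have h : (cycle_len k (par_L k) 0 <= par_Q k)%N.
  apply: dvdn_leq; first exact: seqprod_gt0 (par_qs_gt0 k).
  by apply: dvdn_seqprod; exact: mem_par_qs.
apply: leq_trans h; have := par_a_get k; have := leq_mul (par_N_ge2 k) (leqnn (par_a k)).
by rewrite -/(par_L k) /cycle_len /par_t; lia.
Qed.

Lemma par_W_mono k : (par_W k <= par_W k.+1)%N.
Proof. by rewrite par_WS; have := par_Q_ge k; lia. Qed.

Lemma ndiff_block k b x y : (b <= k)%N ->
  (\sum_(i < par_d k)
     (x %% cycle_len k (par_L k) (b * par_d k + i)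
        != y %% cycle_len k (par_L k) (b * par_d k + i))
   <= ndiff (par_qs k) x y)%N.
Proof.
move=> bk; pose c j := cycle_len k (par_L k) j.
have -> : ndiff (par_qs k) x y = (\sum_(j < k.+1 * par_d k) (x %% c j != y %% c j))%N.
  rewrite /ndiff /par_qs /cycle_lens /mkseq count_map -sum1_count big_mkcond.
  have -> : iota 0%N (par_D k) = index_iota 0%N (par_D k) by rewrite /index_iota subn0.
  rewrite big_mkord; apply: eq_bigr => j _.
  by rewrite -[preim _ _ _]/(x %% c j != y %% c j)%N; case: (_ != _).
rewrite (sum_block _ _ (fun j => (x %% c j != y %% c j)%N : nat)).
rewrite -ltnS in bk; rewrite (bigD1 (Ordinal bk)) //=.
exact: leq_addr.
Qed.

(** * The levels of the system with index [b] *)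

Section OneSystem.
Variable b : nat.

(** Step [k] provides one run of cycle lengths for each index up to [k]. While [k < b] the system
    borrows the last run, and no rigidity is asked of it there. The reduction of [i] makes the
    bounds hold for all [i], as the one-step lemmas require. *)
Definition sys_q (k i : nat) : nat :=
  cycle_len k (par_L k) (minn b k * par_d k + i %% par_d k)%N.

Lemma sys_index_lt k i : (minn b k * par_d k + i %% par_d k < par_D k)%N.
Proof. by apply: block_index_lt; [exact: geq_minr|rewrite ltn_pmod // par_d_gt0]. Qed.

Lemma sys_q_gt0 k i : (0 < sys_q k i)%N.
Proof. by have [] := cycle_len_bounds (sys_index_lt k i). Qed.
Lemma sys_q_le k i : (sys_q k i <= par_N k * par_a k)%N.
Proof. by have [] := cycle_len_bounds (sys_index_lt k i). Qed.
Lemma sys_q_ge k i : (par_N k * par_a k <= sys_q k i + par_t k)%N.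
Proof. by have [] := cycle_len_bounds (sys_index_lt k i). Qed.

Fixpoint sys_fl (k : nat) : int -> nat -> nat :=
  if k is k'.+1 then stepflow (par_L k') (sys_q k') else fun _ y => y.

Lemma sys_flN k n x : (x < par_N k)%N -> (sys_fl k n x < par_N k)%N.
Proof.
case: k => [//|k] /= xN; rewrite par_NS.
exact: (stepflow_lt (par_N_gt0 k) (par_a_gt0 k) (sys_q_gt0 k) (sys_q_le k)).
Qed.

Lemma sys_fl0 k x : sys_fl k 0 x = x.
Proof.
case: k => [//|k] /=.
exact: (stepflow0 (par_N_gt0 k) (par_a_gt0 k) (sys_q_gt0 k)).
Qed.

Lemma sys_flD k m n x : sys_fl k (m + n) x = sys_fl k m (sys_fl k n x).
Proof.
case: k => [//|k] /=.
exact: (stepflowD (par_N_gt0 k) (par_a_gt0 k) (sys_q_gt0 k) (sys_q_le k)).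
Qed.

Definition sys_pi k : nat -> nat := steppi (par_L k) (par_a k) (sys_fl k).

Lemma sys_error k n : (`|n| <= par_W k + k)%N ->
  (2 ^ k * \sum_(y < par_N k.+1)
     (sys_pi k (sys_fl k.+1 n y) != sys_fl k n (sys_pi k y)) <= par_N k.+1)%N.
Proof.
move=> nW.
have h := stepflow_error (par_d k) (par_N_gt0 k) (par_a_gt0 k) (sys_q_gt0 k) (sys_q_ge k) (@sys_flD k) n.
apply: leq_trans (leq_mul (leqnn (2 ^ k)%N) h) _.
rewrite par_NS mulnCA leq_mul2l /par_L; apply/orP; right.
apply: leq_trans (leq_mul (leqnn (par_N k)) (par_a_ge k)).
rewrite mulnCA leq_mul2l; apply/orP; right.
have := leq_mul (leqnn (par_N k)) nW; have := leq_mul (par_N_gt0 k) (leqnn (par_t k)).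
have := leq_mul (par_N_gt0 k) (leqnn `|n|%N).
lia.
Qed.

Lemma sys_fixed k n :
  (\sum_(y < par_N k.+1) (sys_fl k.+1 n y != y) <=
   (\sum_(i < par_d k) (~~ ((sys_q k i)%:Z %| n)%Z)) * par_L k)%N.
Proof. exact: (stepflow_fixed (par_d k) (par_N_gt0 k) (par_a_gt0 k) (sys_q_gt0 k)). Qed.

Lemma sys_corr (R : realFieldType) k C n0 :
  \sum_(m < par_Q k)
    ((\sum_(y < par_N k.+1) (C (sys_pi k y) && C (sys_pi k (sys_fl k.+1 (m%:Z - n0) y)))%:R)
       / (par_N k.+1)%:R - density R (par_N k) C ^+ 2) ^+ 2
  <= (par_Q k)%:R * (2 / k.+1%:R) :> R.
Proof.
have := @stepcorr_variance R (par_N k) (par_a k) (par_d k) (par_t k) (sys_q k) (sys_fl k)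
  (par_N_gt0 k) (par_a_gt0 k) (par_d_gt0 k) (sys_q_gt0 k) (sys_q_le k) (sys_q_ge k)
  (@sys_flN k) (@sys_fl0 k) (@sys_flD k) C (par_qs k) n0 (par_qs_coprime k) (par_qs_gt0 k).
move=> /(_ _ _)/wrap[||h].
- by move=> i _; apply: mem_par_qs; exact: sys_index_lt.
- move=> x y; apply: leq_trans (ndiff_block x y (geq_minr b k)).
  by apply: leq_sum => i _; rewrite /sys_q (modn_small (ltn_ord i)).
apply: le_trans h _; rewrite ler_wpM2l //.
rewrite /par_qs size_mkseq /par_D natrM.
have K0 : 0 < k.+1%:R :> R by rewrite ltr0n.
have K1 : 1 <= k.+1%:R :> R by rewrite -[leLHS]/(1%:R) ler_nat.
have dR : 0 < (par_d k)%:R :> R by rewrite ltr0n par_d_gt0.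
(* [par_D k / par_d k ^ 2] equals [k.+1 / par_d k]: sharing the level with the other systems costs a
   factor [k.+1]. *)
have h1 : k.+1%:R * (par_d k)%:R / (par_d k)%:R ^+ 2 <= k.+1%:R^-1 :> R.
  rewrite expr2 invfM mulrA mulfK ?gt_eqF // ler_pdivrMr // ler_pdivlMl //.
  rewrite -natrM ler_nat /par_d.
  rewrite -[X in (X <= _)%N]/(k.+1 ^ 2)%N; apply: leq_trans (_ : k.+1 ^ 5 <= _)%N.
    by rewrite leq_pexp2l.
  by rewrite leq_pmull.
have L0 : 0 < (par_N k * par_a k)%:R :> R.
  by rewrite ltr0n muln_gt0 par_N_gt0 par_a_gt0.
(* The size [par_N k >= 2] pays for the factor 2, and the [2 ^ k] inside [par_a] for [k.+1]. *)
have h2 : 2 * (par_t k)%:R / (par_N k * par_a k)%:R <= k.+1%:R^-1 :> R.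
  rewrite ler_pdivrMr // ler_pdivlMl // -!natrM ler_nat mulnCA.
  apply: leq_mul (par_N_ge2 k) _; apply: leq_trans (par_a_ge k).
  by apply: leq_mul; [exact: ltn_expl|exact: leq_addl].
have h3 : 0 <= 2 * (par_t k)%:R / (par_N k * par_a k)%:R :> R.
  by apply: divr_ge0; [exact: mulr_ge0|exact: ltW].
have h4 : (2 * (par_t k)%:R / (par_N k * par_a k)%:R) ^+ 2 <= k.+1%:R^-1 :> R.
  apply: (le_trans _ h2); rewrite expr2 ler_piMr //.
  by apply: (le_trans h2); rewrite invf_le1.
by apply: le_trans (lerD h1 h4) _; rewrite -mulr2n -[leLHS]mulr_natl.
Qed.

(* Reorders level k so that sys_pi becomes integer division. *)
Fixpoint sys_sigma (k y : nat) : nat :=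
  if k is k'.+1 then
    let w := sys_sigma k' (y %/ (par_d k' * par_a k'))%N in
    let i := ((y %% (par_d k' * par_a k')) %/ par_a k')%N in
    let j := (y %% par_a k')%N in
    (i * par_L k' + (sys_fl k' (- j%:Z) w * par_a k' + j))%N
  else y.

Lemma div_lt k y : (y < par_N k.+1)%N -> (y %/ (par_d k * par_a k) < par_N k)%N.
Proof.
have da : (0 < par_d k * par_a k)%N by rewrite muln_gt0 par_d_gt0 par_a_gt0.
by rewrite ltn_divLR // par_NS /par_L mulnCA.
Qed.

Lemma block_coord_lt k x j : (x < par_N k)%N -> (j < par_a k)%N ->
  (x * par_a k + j < par_L k)%N.
Proof.
move=> xN ja; apply: (@leq_trans (x.+1 * par_a k)); first by rewrite mulSn addnC ltn_add2r.
by rewrite /par_L leq_mul2r xN orbT.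
Qed.

Lemma sys_sigmaN k y : (y < par_N k)%N -> (sys_sigma k y < par_N k)%N.
Proof.
elim: k y => [//|k IH] y yN /=.
have da : (0 < par_d k * par_a k)%N by rewrite muln_gt0 par_d_gt0 par_a_gt0.
have xN := sys_flN (- (y %% par_a k)%N%:Z) (IH _ (div_lt yN)).
have h := block_coord_lt xN (ltn_pmod y (par_a_gt0 k)).
have id : ((y %% (par_d k * par_a k)) %/ par_a k < par_d k)%N.
  by rewrite ltn_divLR ?par_a_gt0 // ltn_pmod.
rewrite par_NS; move: h id; set r := (_ * par_a k + _)%N; set i := (_ %/ par_a k)%N => h id.
apply: (@leq_trans (i.+1 * par_L k)); first by rewrite mulSn addnC ltn_add2r.
by rewrite leq_mul2r id orbT.
Qed.

(** At offset [j] the reordering stores [sys_fl k (- j) w], which the projection carries forward by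
    [j], back to [w]. *)
Lemma sys_pi_sigma k y : (y < par_N k.+1)%N ->
  sys_pi k (sys_sigma k.+1 y) = sys_sigma k (y %/ (par_d k * par_a k))%N.
Proof.
move=> yN /=; have wN := sys_sigmaN (div_lt yN).
have ja := ltn_pmod y (par_a_gt0 k).
have h := block_coord_lt (sys_flN (- (y %% par_a k)%N%:Z) wN) ja.
rewrite /sys_pi /steppi modnMDl (modn_small h) divnMDl ?par_a_gt0 // (divn_small ja) addn0.
rewrite {1}/par_L mulnA addnA -mulnDl modnMDl modn_small //.
by rewrite -sys_flD subrr sys_fl0.
Qed.

Lemma sys_sigma_inj k x y : (x < par_N k)%N -> (y < par_N k)%N ->
  sys_sigma k x = sys_sigma k y -> x = y.
Proof.
elim: k x y => [//|k IH] x y xN yN e.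
have e1 := IH _ _ (div_lt xN) (div_lt yN) (etrans (esym (sys_pi_sigma xN)) (etrans (congr1 _ e) (sys_pi_sigma yN))).
have hx := block_coord_lt (sys_flN (- (x %% par_a k)%N%:Z) (sys_sigmaN (div_lt xN))) (ltn_pmod x (par_a_gt0 k)).
have hy := block_coord_lt (sys_flN (- (y %% par_a k)%N%:Z) (sys_sigmaN (div_lt yN))) (ltn_pmod y (par_a_gt0 k)).
have L0 : (0 < par_L k)%N by rewrite muln_gt0 par_N_gt0 par_a_gt0.
have e2 := congr1 (fun z => z %/ par_L k)%N e.
rewrite /= !divnMDl // (divn_small hx) (divn_small hy) !addn0 in e2.
have e3 := congr1 (fun z => z %% par_a k)%N e.
have modE i u v : ((i * par_L k + (u * par_a k + v)) %% par_a k = v %% par_a k)%N.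
  by rewrite /par_L mulnA addnA -mulnDl modnMDl.
rewrite /= !modE !modn_mod in e3.
rewrite [LHS](divn_eq x (par_d k * par_a k)) [RHS](divn_eq y (par_d k * par_a k)) e1.
congr (_ + _)%N; rewrite [LHS](divn_eq _ (par_a k)) [RHS](divn_eq _ (par_a k)) e2.
by congr (_ + _)%N; rewrite !(modn_dvdm _ (dvdn_mull (par_d k) (dvdnn (par_a k)))).
Qed.

End OneSystem.

(** * All levels realized by one uniform variable on the unit interval *)

Section UnitInterval.
Variable R : realType.

Definition unit_law : set (measurableTypeR R) -> \bar R :=
  mrestr (@lebesgue_measure R) (measurable_itv `[0%R, 1%R[).

HB.instance Definition _ := Measure.on unit_law.

Lemma unit_law_setT : unit_law setT = 1%E.
Proof.
rewrite /unit_law /mrestr setTI lebesgue_measure_itv /= lte_fin ltr01.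
by rewrite oppr0 adde0.
Qed.

HB.instance Definition _ :=
  Measure_isProbability.Build _ _ _ unit_law unit_law_setT.

Definition unit_prob : probability (measurableTypeR R) R := unit_law.

(** The value 0 outside [0, 1), a null set, makes [digit_lt] and [digit_div] hold at every point. *)
Definition digit (M : nat) (w : measurableTypeR R) : nat :=
  if 0 <= (w : R) < 1 then Num.truncn (M%:R * (w : R)) else 0%N.

Lemma digit_lt M w : (0 < M)%N -> (digit M w < M)%N.
Proof.
move=> M0; rewrite /digit; case: ifP => // /andP[w0 w1].
have h : 0 <= M%:R * (w : R) by rewrite mulr_ge0.
have /andP[l _] := truncn_itv h; rewrite -(@ltr_nat R); apply: le_lt_trans l _.
by rewrite -[ltRHS]mulr1 ltr_pM2l ?ltr0n.
Qed.

Lemma digit_div M c w : (0 < c)%N -> (digit (M * c) w %/ c)%N = digit M w.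
Proof.
move=> c0; rewrite /digit; case: ifP => [/andP[w0 w1]|_]; last by rewrite div0n.
have cR : 0 < c%:R :> R by rewrite ltr0n.
have h : 0 <= M%:R * (w : R) by rewrite mulr_ge0.
have h' : 0 <= (M * c)%:R * (w : R) by rewrite mulr_ge0.
apply/esym/truncn_def; have /andP[l u] := truncn_itv h'; apply/andP; split.
  rewrite -(ler_pM2r cR) -natrM; apply: le_trans (_ : (M * c)%:R * w <= _); last by rewrite natrM mulrAC.
  by apply: le_trans l; rewrite ler_nat leq_trunc_div.
rewrite -(ltr_pM2r cR) -natrM; apply: le_lt_trans (_ : _ <= (M * c)%:R * w) _.
  by rewrite natrM mulrAC.
apply: lt_le_trans u _; rewrite ler_nat; exact: ltn_ceil.
Qed.

Lemma digit_set M j : (0 < M)%N ->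
  [set w | digit M w = j] =
  (`[j%:R / M%:R, j.+1%:R / M%:R[ `&` `[0, 1[) `|`
  (if j == 0%N then ~` `[0, 1[ else set0).
Proof.
move=> M0; have MR : 0 < M%:R :> R by rewrite ltr0n.
apply/seteqP; split => w /=; rewrite /digit !in_itv /=.
  case: ifP => [/andP[w0 w1] <-|/negP h <-].
    left; split => //; have h : 0 <= M%:R * (w : R) by rewrite mulr_ge0.
    have /andP[l u] := truncn_itv h.
    by apply/andP; split;
      [rewrite ler_pdivrMr // [leRHS]mulrC|rewrite ltr_pdivlMr // [ltLHS]mulrC].
  by right; rewrite /= in_itv.
move=> [[h w01]|]; rewrite ?w01.
  by apply: truncn_def; move: h; rewrite ler_pdivrMr // ltr_pdivlMr // [w * _]mulrC.
by case: (j =P 0%N) => [->|_] //=; rewrite in_itv => /negP/negbTE ->.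
Qed.

Lemma measurable_digit M j : (0 < M)%N -> measurable [set w | digit M w = j].
Proof.
move=> M0; rewrite digit_set //; apply: measurableU; first exact: measurableI.
by case: ifP => // _; exact: measurableC.
Qed.

Lemma pr_digit M j : (j < M)%N -> pr unit_prob [set w | digit M w = j] = M%:R^-1.
Proof.
move=> jM; have M0 : (0 < M)%N by exact: leq_ltn_trans jM.
have MR : 0 < M%:R :> R by rewrite ltr0n.
rewrite /pr /unit_prob /= /unit_law /mrestr digit_set //.
rewrite (_ : (_ `|` _) `&` _ = `[j%:R / M%:R, j.+1%:R / M%:R[%classic); last first.
  apply/seteqP; split => w /=.
    case=> hU w01; case: hU => [[hI _]|] //; case: ifP => //= _ nw; by case: nw.
  move=> h; suff w01 : `[0, 1[%classic w by split => //; left.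
  move: h; rewrite /= !in_itv /= => /andP[h1 h2].
  have j0 : 0 <= j%:R / M%:R :> R by apply: divr_ge0 => //; exact: ltW.
  rewrite (le_trans j0 h1) (lt_le_trans h2) //.
  by rewrite ler_pdivrMr // mul1r ler_nat.
rewrite lebesgue_measure_itv /= lte_fin ltr_pM2r ?invr_gt0 // ltr_nat ltnSn /=.
by rewrite -mulrBl -natr1 addrAC subrr add0r mul1r.
Qed.

(** One [w] drives all levels: the digits are nested by [digit_div], and [sys_sigma] turns this
    nesting into compatibility with [sys_pi]. *)
Definition sys_Z (b k : nat) (w : measurableTypeR R) : nat :=
  sys_sigma b k (digit (par_N k) w).

Lemma sys_ZN b k w : (sys_Z b k w < par_N k)%N.
Proof. by apply: sys_sigmaN; apply: digit_lt; exact: par_N_gt0. Qed.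

Lemma measurable_sys_Z b k y : measurable [set w | sys_Z b k w = y].
Proof.
rewrite (_ : [set w | _] = \bigcup_(j in [set j | sys_sigma b k j = y])
    [set w | digit (par_N k) w = j]).
  by apply: bigcup_measurable => j _; apply: measurable_digit; exact: par_N_gt0.
apply/seteqP; split => w; first by move=> /= h; exists (digit (par_N k) w).
by move=> [j /= <- <-].
Qed.

Lemma pr_sys_Z b k y : (y < par_N k)%N ->
  pr unit_prob [set w | sys_Z b k w = y] = (par_N k)%:R^-1.
Proof.
move=> yN.
pose h (j : 'I_(par_N k)) : 'I_(par_N k) := Ordinal (sys_sigmaN b (ltn_ord j)).
have /injF_bij[g _ hg] : injective h.
  by move=> i j /(congr1 val) /= /(sys_sigma_inj (ltn_ord i) (ltn_ord j)) /val_inj.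
pose j := g (Ordinal yN).
have jy : sys_sigma b k j = y by have /(congr1 val) := hg (Ordinal yN).
rewrite -(pr_digit (ltn_ord j)); congr pr; apply/seteqP; split => w /=.
  rewrite -jy => /sys_sigma_inj; apply; last exact: ltn_ord.
  by apply: digit_lt; exact: par_N_gt0.
by rewrite /sys_Z => ->.
Qed.

Lemma sys_piZ b k w : sys_pi b k (sys_Z b k.+1 w) = sys_Z b k w.
Proof.
rewrite /sys_Z sys_pi_sigma; last by apply: digit_lt; exact: par_N_gt0.
congr sys_sigma; rewrite par_NS /par_L mulnCA digit_div //.
by rewrite muln_gt0 par_d_gt0 par_a_gt0.
Qed.

Lemma sys_errZ b k n : (`|n| <= par_W k + k)%N ->
  pr unit_prob [set w | sys_pi b k (sys_fl b k.+1 n (sys_Z b k.+1 w))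
                         != sys_fl b k n (sys_Z b k w)] <= 2^-1 ^+ k.
Proof.
move=> nW; have := sys_error b nW.
rewrite (_ : [set w | _] = ev (sys_Z b) k.+1 (fun y => sys_pi b k (sys_fl b k.+1 n y) != sys_fl b k n (sys_pi b k y))); last first.
  by apply/seteqP; split => w; rewrite /ev /= sys_piZ.
rewrite (pr_ev (sys_ZN b) (measurable_sys_Z b) (@pr_sys_Z b)).
rewrite -(ler_nat R) natrM natr_sum => h.
have NR : 0 < (par_N k.+1)%:R :> R by rewrite ltr0n par_N_gt0.
rewrite ler_pdivrMr // exprVn ler_pdivlMl ?exprn_gt0 // -natrX.
exact: h.
Qed.

End UnitInterval.

(** * The set [S] and its translates *)

(** Assigns to each system the translate it has to serve; an index that codes no integer gets 0, so
    that every index has one. *)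
Definition shift (b : nat) : int := odflt 0 (unpickle b).

Lemma shift_pickle m : shift (pickle m) = m.
Proof. by rewrite /shift pickleK. Qed.

(** For each [b <= k] the proportion of bad cycle lengths is at most [1/k.+1]. The bound on [n]
    keeps it in the window of level [k.+1], where tame sets are still approximated. *)
Definition rig_set : set int := [set n | exists k, (`|n| <= par_W k.+1)%N /\
  forall b, (b <= k)%N ->
    (k.+1 * \sum_(i < par_d k)
       (~~ ((cycle_len k (par_L k) (b * par_d k + i))%:Z %| (n + shift b)%R)%Z)
     <= par_d k)%N].

Lemma par_crt k (z : nat -> int) : exists2 c, (c < par_Q k)%N &
  forall b i, (b <= k)%N -> (i < par_d k)%N ->
    ((cycle_len k (par_L k) (b * par_d k + i))%:Z %| c%:Z - z b)%Z.
Proof.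
have Q0 : (0 < par_Q k)%N by exact: seqprod_gt0 (par_qs_gt0 k).
(* [j %/ par_d k] is the index of the system that owns the [j]-th cycle length. *)
pose r j := `|(z (j %/ par_d k)%N %% (cycle_len k (par_L k) j)%:Z)%Z|%N.
have [c hc] := crt_seq r (par_qs_coprime k) (par_qs_gt0 k).
exists (c %% par_Q k)%N; first exact: ltn_pmod.
move=> b i bk id; set j := (b * par_d k + i)%N.
have jD : (j < par_D k)%N by exact: block_index_lt.
have [q0 _ _] := cycle_len_bounds jD.
have := hc j; rewrite /par_qs size_mkseq nth_mkseq // => /(_ jD) e.
have qQ : (cycle_len k (par_L k) j %| par_Q k)%N.
  by apply: dvdn_seqprod; exact: mem_par_qs.
rewrite -eqz_mod_dvd modz_nat modn_dvdm // e -modz_nat /r gez0_abs.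
  by rewrite modz_mod divnMDl ?par_d_gt0 // divn_small // addn0.
by rewrite modz_ge0 //; lia.
Qed.

Lemma rig_set_unbounded (M : nat) : exists2 n, rig_set n & (M%:Z <= n)%R.
Proof.
pose k := M.
have [c cQ hc] := par_crt k (fun b => - shift b).
(* Adding the period [par_Q k] makes the element large without changing its residues. *)
exists (c + par_Q k)%N%:Z; last first.
  by have := par_Q_ge k; rewrite /k; lia.
exists k; split; first by rewrite par_WS /=; lia.
move=> b bk; rewrite big1 ?muln0 // => i _.
have qQ : ((cycle_len k (par_L k) (b * par_d k + i))%:Z %| (par_Q k)%:Z)%Z.
  by rewrite /dvdz /=; apply: dvdn_seqprod; apply: mem_par_qs; exact: block_index_lt.
have := hc b i bk (ltn_ord i); rewrite opprK => h.
by apply/eqP; rewrite eqb0 negbK PoszD addrAC rpredD.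
Qed.

Lemma translate_infinite m : ~ finite_set (translate rig_set m).
Proof.
move=> /finite_seqP[s sE].
pose M := (\max_(n <- s) `|n|)%N.
have [n Sn Mn] := rig_set_unbounded (M + `|m|).+1.
have : translate rig_set m (n + m) by exists n.
rewrite sE /= => ns.
have := @leq_bigmax_seq _ s xpredT (fun n : int => `|n|%N) _ ns isT.
by rewrite -/M; move: Mn; lia.
Qed.

(** The return time is [a - b = n + m] with [n] in [S]. For system [j] the number [n + shift j] must
    be divisible by most cycle lengths, so [a - b] must be congruent to [m - shift j]; these are the
    residues given to [c]. *)
Lemma translate_recurrence (R : realType) m :
  set_of_recurrence R (translate rig_set m).
Proof.
move=> d X mu T Tinv hT D mD D0.
have fD : mu D \is a fin_num by exact: fin_num_measure.
have D0' : 0 < fine (mu D) by rewrite fine_gt0 // D0 -ge0_fin_numE.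
(* The first bound keeps [a - b - m] in the window [2 * par_Q k + k], the second makes the measure
   of [D] exceed [1/k.+1]. *)
pose k := maxn `|m| (Num.bound (fine (mu D))^-1).
have mk : (`|m| <= k)%N by exact: leq_maxl.
have kD : ((k.+1%:R^-1)%:E < mu D)%E.
  rewrite -(fineK fD) lte_fin -[ltRHS]invrK ltf_pV2 ?posrE ?invr_gt0 //.
  apply: lt_le_trans (archi_boundP _) _; first by rewrite invr_ge0 ltW.
  by rewrite ler_nat leqW // leq_maxr.
have [c cQ hc] := par_crt k (fun b => m - shift b).
(* With [K = k.+1] the left side is [4 K^8], the square of [2 K^4]. The successor turns the strict
   inequality of [return_times] into at most [2 K^4] wrong residues, and [K] times that is
   [par_d k]. *)
have hs : (2 * size (par_qs k) * k.+1 ^ 2 <= (2 * k.+1 ^ 4).+1 ^ 2)%N.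
  rewrite /par_qs size_mkseq /par_D /par_d.
  by move: k.+1 => K; rewrite !expnS expn0; lia.
have [a [b [aQ bQ hab h0]]] := return_times hT c (par_qs_coprime k) (par_qs_gt0 k) mD
  (ltn0Sn k) kD hs (ltn0Sn _).
exists (a%:Z - b%:Z); last exact: h0.
exists (a%:Z - b%:Z - m); last by rewrite subrK.
exists k; split; first by rewrite par_WS; move: aQ bQ; rewrite -/(par_Q k); lia.
move=> j jk.
apply: (@leq_trans (k.+1 * ndiff (par_qs k) a (b + c))); last first.
  apply: leq_trans (leq_mul (leqnn k.+1) (_ : _ <= 2 * k.+1 ^ 4)%N) _; first exact: hab.
  by rewrite /par_d mulnCA -expnS.
rewrite leq_mul2l; apply/orP; right.
apply: leq_trans (ndiff_block a (b + c) jk); apply: leq_sum => i _.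
case: eqVneq => [e|_]; last exact: leq_b1.
have h := hc j i jk (ltn_ord i).
rewrite leqn0 eqb0 negbK.
set q := cycle_len _ _ _ in e h *.
have : (q%:Z %| a%:Z - (b + c)%N%:Z)%Z by rewrite -eqz_mod_dvd !modz_nat e.
move=> h'; have := rpredD h' h.
by congr (dvdz _ _); rewrite PoszD; lia.
Qed.

(** The system with index [pickle m] has shift [m], so membership of [n] in [S] at a level [k >= b]
    says that most of its cycle lengths divide [n + m]. The slack [|m|] accounts for the translation
    of the window. *)
Lemma translate_rigidity (R : realType) m :
  WM_set_of_rigidity R (translate rig_set m).
Proof.
pose b := pickle m.
exists _, _, (tower_law par_W (@sys_flN b) (@sys_fl0 b) (@sys_flD b)
  (@sys_ZN R b) (@measurable_sys_Z R b) (@pr_sys_Z R b)),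
  (Tn (sys_fl b) 1), (Tn (sys_fl b) (- 1)).
split.
- exact: tower_mps.
- apply: (tower_nontrivial _ _ _ _ _ _ (@sys_piZ R b) par_W_mono (@sys_errZ R b)).
  by [].
- apply: (tower_weak_mixing par_N_gt0 _ _ _ _ _ _ (@sys_piZ R b) (b := 0%N)
    (Q := par_Q) (eta := fun k => 2 / k.+1%:R)).
  + move=> k _; rewrite (seqprod_gt0 (par_qs_gt0 k)) par_WS /=; lia.
  + move=> k C n0 _; exact: sys_corr.
  + move=> x x0; exists (Num.bound (2 / x)) => k hk.
    rewrite ler_pdivrMr // mulrC -ler_pdivrMr //.
    have h2 : 0 <= 2 / x by apply: divr_ge0 => //; exact: ltW.
    apply: le_trans (ltW (archi_boundP h2)) _.
    by rewrite ler_nat leqW.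
- apply: (tower_rigidity _ _ _ _ _ _ par_W_mono (b := b) (J := `|m|%N)).
    exact: translate_infinite.
  move=> _ [n [k [nW hn]] <-]; exists k; split; first by lia.
  move=> bk.
  have -> : [set w | sys_fl b k.+1 (n + m) (sys_Z b k.+1 w) != sys_Z b k.+1 w] =
      ev (sys_Z (R := R) b) k.+1 (fun y => sys_fl b k.+1 (n + m) y != y) by [].
  rewrite (pr_ev (sys_ZN b) (measurable_sys_Z b) (@pr_sys_Z R b)).
  have NR : 0 < (par_N k.+1)%:R :> R by rewrite ltr0n par_N_gt0.
  rewrite ler_pdivrMr // ler_pdivlMl // -natr_sum -natrM ler_nat.
  apply: leq_trans (leq_mul (leqnn k.+1) (sys_fixed b k (n + m))) _.
  rewrite mulnA par_NS leq_mul2r; apply/orP; right.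
  apply: leq_trans (hn b bk); rewrite leq_mul2l; apply/orP; right.
  apply: leq_sum => i _; rewrite /sys_q (minn_idPl bk) (modn_small (ltn_ord i)).
  by rewrite shift_pickle.
Qed.

Theorem theorem2p1 (R : realType) :
  exists S : set int, forall m : int,
    set_of_recurrence R (translate S m) /\ WM_set_of_rigidity R (translate S m).
Proof.
exists rig_set => m; split; [exact: translate_recurrence|exact: translate_rigidity].
Qed.
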